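(* If $\tilde w=t^{k\alpha_1+2k\alpha_2}\tau$ with $k\in\mathbb{N}$, then $$f_{\tilde w,\mathbb{O}}=\begin{cases}(v-v^{-1})^2,&\mathbb{O}=\mathbb{O}_{\lambda,\tau}\text{ with }\lambda\in\bigsqcup_{j=2}^kE'_{j\alpha_1+(2j-1)\alpha_2,\tau},\\ v-v^{-1},&\mathbb{O}=\mathbb{O}_{i,\tau}\text{ with }-k+1\leq i\leq2k,\\ 1,&\mathbb{O}=\mathbb{O}_{id,\tau},\\ 0,&\text{otherwise.}\end{cases}$$
   Context: $W=\langle s_1,s_2\rangle$ is the finite Weyl group of type $A_2$; $\alpha_1,\alpha_2$ are the simple roots, identified with the simple coroots ($\langle\alpha_i,\alpha_i\rangle=2$, $\langle\alpha_1,\alpha_2\rangle=-1$); $Q=\mathbb{Z}\alpha_1\oplus\mathbb{Z}\alpha_2$; $P$ is the coweight lattice, $P_+$ its dominant elements; $\widetilde W=P\rtimes W$ with translations $t^\lambda$. $W_a=Q\rtimes W$ is the Coxeter group generated by $s_0=t^{\alpha_1+\alpha_2}s_1s_2s_1$, $s_1$, $s_2$; $\widetilde W=W_a\rtimes\langle\tau\rangle$ with $\tau^3=1$, $\tau s_0\tau^{-1}=s_1$, $\tau s_1\tau^{-1}=s_2$, $\tau s_2\tau^{-1}=s_0$, i.e. $\tau=t^{(2\alpha_1+\alpha_2)/3}s_1s_2$; $\ell(w\tau^j)=\ell(w)$ for $w\in W_a$. $\mathbb{N}$ contains $0$. Class polynomials: $\widetilde H$ is the algebra over $\mathbb{Z}[v,v^{-1}]$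 with basis $T_{\tilde w}$ ($\tilde w\in\widetilde W$), $T_{\tilde x}T_{\tilde y}=T_{\tilde x\tilde y}$ if $\ell(\tilde x)+\ell(\tilde y)=\ell(\tilde x\tilde y)$, and $(T_s-v)(T_s+v^{-1})=0$ for $s\in\{s_0,s_1,s_2\}$. $[\widetilde H,\widetilde H]$ is the submodule spanned by commutators. For a conjugacy class $\mathbb{O}$ of $\widetilde W$, $T_{\mathbb{O}}$ is the image in $\widetilde H/[\widetilde H,\widetilde H]$ of $T_{w}$ for any minimal length $w\in\mathbb{O}$; by He–Nie this is well defined and the $T_{\mathbb{O}}$ form a basis. The class polynomials $f_{\tilde w,\mathbb{O}}$ are the unique coefficients with $T_{\tilde w}\equiv\sum_{\mathbb{O}}f_{\tilde w,\mathbb{O}}T_{\mathbb{O}}\bmod[\widetilde H,\widetilde H]$. Conjugacy classes of $\widetilde W$ in $W_a\tau$: $\mathbb{O}_{id,\tau}=\{t^{m\alpha_1+n\alpha_2}\tau,\ t^{m\alpha_1+n\alpha_2}s_1s_2\tau\mid m,n\in\mathbb{Z}\}$; for $\lambda\in P_+\cap Q$ not of the form $2m\alpha_1+m\alpha_2$ ($m\geq0$), $\mathbb{O}_{\lambda,\tau}$ is the class of $t^\lambda s_2s_1\tau$; for $i\in\mathbb{Z}$, $\mathbb{O}_{i,\tau}=\{t^{k\alpha_1+i\alpha_2}s_1s_2s_1\tau,\ t^{(k+i-1)\alpha_1+k\alpha_2}s_2\tau,\ t^{(1-i)\alpha_1+k\alpha_2}s_1\tau\mid k\in\mathbb{Z}\}$.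 $E'_{m\alpha_1+n\alpha_2,\tau}=\{m\alpha_1+k\alpha_2\mid\lfloor\frac{m+1}2\rfloor+1\leq k\leq n\}$. *)

(* Defs.v *)
From HB Require Import structures.
From mathcomp Require Import all_boot all_order all_algebra all_fingroup.
From mathcomp Require Import zify ring.
From mathcomp Require Import boolp classical_sets functions cardinality fsbigop.

Set Implicit Arguments.
Unset Strict Implicit.
Unset Printing Implicit Defensive.

Import Order.TTheory GRing.Theory Num.Theory.

Local Open Scope classical_set_scope.
Local Open Scope ring_scope.

(* Z[v, v^-1] is realised inside the fraction field of Z[v], v being 'X. *)
Definition is_laurent : {pred {fraction {poly int}}} :=
  fun x => `[< exists (p : {poly int}) (n : nat), x * tofrac 'X^n = tofrac p >].

Lemma is_laurent_subring : subring_closed is_laurent.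
Proof.
split.
- by apply/asboolP; exists 1, 0; rewrite mul1r.
- move=> x y /asboolP[p [m xp]] /asboolP[q [n yq]]; apply/asboolP.
  exists (p * 'X^n - q * 'X^m), (m + n)%N.
  rewrite exprD rmorphB !rmorphM /= -xp -yq; ring.
- move=> x y /asboolP[p [m xp]] /asboolP[q [n yq]]; apply/asboolP.
  exists (p * q), (m + n)%N.
  rewrite exprD !rmorphM /= -xp -yq; ring.
Qed.

HB.instance Definition _ :=
  GRing.isSubringClosed.Build {fraction {poly int}} is_laurent
    is_laurent_subring.

Record laurent := Laurent {
  laurent_val :> {fraction {poly int}};
  laurentP : laurent_val \in is_laurent }.

HB.instance Definition _ := [isSub for laurent_val].
HB.instance Definition _ := [Choice of laurent by <:].
HB.instance Definition _ := [SubChoice_isSubComNzRing of laurent by <:].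

Lemma v_subproof : (tofrac 'X : {fraction {poly int}}) \in is_laurent.
Proof. by apply/asboolP; exists 'X, 0; rewrite mulr1. Qed.

Lemma vinv_subproof : ((tofrac 'X)^-1 : {fraction {poly int}}) \in is_laurent.
Proof.
apply/asboolP; exists 1, 1%N.
by rewrite expr1 rmorph1 mulVf // tofrac_eq0 polyX_eq0.
Qed.

Definition v : laurent := Laurent v_subproof.
Definition vinv : laurent := Laurent vinv_subproof.

Lemma mulvV : v * vinv = 1.
Proof.
by apply: val_inj; rewrite rmorphM rmorph1 /= divff // tofrac_eq0 polyX_eq0.
Qed.

(* [(a, b)] is the coweight with <(a, b), alpha1> = a and <(a, b), alpha2> = b,
   i.e. the coordinates are those in the basis of fundamental coweights. *)
Definition coweight : Type := (int * int)%type.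
HB.instance Definition _ := GRing.Zmodule.on coweight.

Definition alpha1 : coweight := (2, -1).
Definition alpha2 : coweight := (-1, 2).

Definition qvec (m n : int) : coweight := alpha1 *~ m + alpha2 *~ n.

(* (2 alpha1 + alpha2) / 3 *)
Definition omega1 : coweight := (1, 0).

Lemma omega1E : omega1 *+ 3 = qvec 2 1.
Proof. by []. Qed.

Lemma qvecE m n : qvec m n = (2 * m - n, 2 * n - m).
Proof.
have mulzE (x y : int) k : ((x, y) : coweight) *~ k = (x * k, y * k).
  have -> : ((x, y) : coweight) *~ k
      = ((((x, y) : int * int) *~ k).1, (((x, y) : int * int) *~ k).2).
    by case: (_ *~ _).
  by rewrite !raddfMz /= !mulrzz.
by rewrite /qvec !mulzE; congr pair => /=; ring.
Qed.

Definition dominant (lam : coweight) : Prop := 0 <= lam.1 /\ 0 <= lam.2.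

Definition i0 : 'I_3 := @Ordinal 3 0 isT.
Definition i1 : 'I_3 := @Ordinal 3 1 isT.
Definition i2 : 'I_3 := @Ordinal 3 2 isT.

(* W is realised as 'S_3, acting on P = Z^3 / Z(1,1,1) by permutation of the
   coordinates x_0, x_1, x_2, where <x, alpha1> = x_0 - x_1 and
   <x, alpha2> = x_1 - x_2.  Since (w * w') i = w' (w i) in 'S_3, the formula
   (w x)_i = x_(w i) defines a left action. *)
Definition coord (lam : coweight) (i : 'I_3) : int :=
  [:: lam.1 + lam.2; lam.2; 0]`_i.

Definition wact (w : 'S_3) (lam : coweight) : coweight :=
  (coord lam (w i0) - coord lam (w i1), coord lam (w i1) - coord lam (w i2)).

Lemma ord3P (P : 'I_3 -> Prop) : P i0 -> P i1 -> P i2 -> forall i, P i.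
Proof.
move=> P0 P1 P2 [[|[|[|//]]] lti].
- by rewrite (_ : Ordinal lti = i0) //; apply: val_inj.
- by rewrite (_ : Ordinal lti = i1) //; apply: val_inj.
- by rewrite (_ : Ordinal lti = i2) //; apply: val_inj.
Qed.

Lemma coord_wact w lam i :
  coord (wact w lam) i = coord lam (w i) - coord lam (w i2).
Proof. by elim/ord3P: i; rewrite /wact {1}/coord /=; ring. Qed.

Lemma wact1 lam : wact 1 lam = lam.
Proof.
by case: lam => a b; rewrite /wact !perm1 /coord /=; congr pair; ring.
Qed.

Lemma wactM w w' lam : wact (w * w')%g lam = wact w (wact w' lam).
Proof.
by rewrite [in RHS]/wact !coord_wact /wact !permM; congr pair; ring.
Qed.

Lemma wactD w lam mu : wact w (lam + mu) = wact w lam + wact w mu.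
Proof.
have cD i : coord (lam + mu) i = coord lam i + coord mu i.
  by elim/ord3P: i; rewrite /coord /=; ring.
by rewrite /wact !cD; congr pair => /=; ring.
Qed.

Definition w1 : 'S_3 := tperm i0 i1.
Definition w2 : 'S_3 := tperm i1 i2.

Lemma wact_w1 lam : wact w1 lam = lam - alpha1 *~ lam.1.
Proof.
have -> : alpha1 *~ lam.1 = qvec lam.1 0 by rewrite /qvec mulr0z addr0.
rewrite qvecE /wact /w1 tpermL tpermR tpermD // /coord.
by case: lam => a b /=; congr pair => /=; ring.
Qed.

Lemma wact_w2 lam : wact w2 lam = lam - alpha2 *~ lam.2.
Proof.
have -> : alpha2 *~ lam.2 = qvec 0 lam.2 by rewrite /qvec mulr0z add0r.
rewrite qvecE /wact /w2 tpermL tpermR tpermD // /coord.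
by case: lam => a b /=; congr pair => /=; ring.
Qed.

(* [ExtAff lam w] is t^lam w. *)
Record ext_aff := ExtAff { transl : coweight; linpart : 'S_3 }.

Definition ext_aff_pair (x : ext_aff) := (transl x, linpart x).
Definition pair_ext_aff (p : coweight * 'S_3) := ExtAff p.1 p.2.
Lemma ext_aff_pairK : cancel ext_aff_pair pair_ext_aff. Proof. by case. Qed.
HB.instance Definition _ := Choice.copy ext_aff (can_type ext_aff_pairK).

Definition ext_aff_one : ext_aff := ExtAff 0 1%g.
Definition ext_aff_mul (x y : ext_aff) : ext_aff :=
  ExtAff (transl x + wact (linpart x) (transl y)) (linpart x * linpart y)%g.
Definition ext_aff_inv (x : ext_aff) : ext_aff :=
  ExtAff (- wact (linpart x)^-1%g (transl x)) (linpart x)^-1%g.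

Lemma wact0 w : wact w 0 = 0.
Proof. by apply: (addrI (wact w 0)); rewrite -wactD !addr0. Qed.

Lemma wactN w lam : wact w (- lam) = - wact w lam.
Proof. by apply: (addrI (wact w lam)); rewrite -wactD !subrr wact0. Qed.

Lemma ext_aff_mulA : associative ext_aff_mul.
Proof.
by move=> x y z; rewrite /ext_aff_mul /= wactD wactM addrA mulgA.
Qed.

Lemma ext_aff_mul1 : left_id ext_aff_one ext_aff_mul.
Proof. by case=> l w; rewrite /ext_aff_mul /= wact1 add0r mul1g. Qed.

Lemma ext_aff_mulr1 : right_id ext_aff_one ext_aff_mul.
Proof. by case=> l w; rewrite /ext_aff_mul /= wact0 addr0 mulg1. Qed.

Lemma ext_aff_mulV : left_inverse ext_aff_one ext_aff_inv ext_aff_mul.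
Proof. by case=> l w; rewrite /ext_aff_mul /= addNr mulVg. Qed.

Lemma ext_aff_mulrV : right_inverse ext_aff_one ext_aff_inv ext_aff_mul.
Proof.
by case=> l w; rewrite /ext_aff_mul /= wactN -wactM mulgV wact1 subrr.
Qed.

HB.instance Definition _ := isGroup.Build ext_aff
  ext_aff_mulA ext_aff_mul1 ext_aff_mulr1 ext_aff_mulV ext_aff_mulrV.

Definition t (lam : coweight) : ext_aff := ExtAff lam 1%g.
Definition s1 : ext_aff := ExtAff 0 w1.
Definition s2 : ext_aff := ExtAff 0 w2.
Definition s0 : ext_aff := (t (alpha1 + alpha2) * s1 * s2 * s1)%g.
Definition tau : ext_aff := (t omega1 * s1 * s2)%g.

Definition simple_refl : seq ext_aff := [:: s0; s1; s2].

Definition has_word (w : ext_aff) (n : nat) : Prop :=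
  exists (u : seq ext_aff) (j : nat),
    [/\ {subset u <= simple_refl}, size u = n &
        w = ((\prod_(s <- u) s) * tau ^+ j)%g].

(* The length: the least n with [has_word w n].  As W_a is normal in the
   group and meets <tau> trivially, this is the Coxeter length of the
   W_a-component of w. *)
Definition ell (w : ext_aff) : nat :=
  xget 0%N [set n | has_word w n /\ forall m, has_word w m -> (n <= m)%N].

Definition conj_class_of (x : ext_aff) : set ext_aff :=
  [set (x ^ g)%g | g in [set: ext_aff]].

Definition conj_classes : set (set ext_aff) := range conj_class_of.

Definition min_length_in (O : set ext_aff) (x : ext_aff) : Prop :=
  O x /\ forall y, O y -> (ell x <= ell y)%N.

Record is_hecke_algebra (H : algType laurent) (T : ext_aff -> H) : Prop := {
  hecke_span : forall h : H, exists (u : seq ext_aff) (c : ext_aff -> laurent),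
    h = \sum_(x <- u) c x *: T x;
  hecke_free : forall (u : seq ext_aff) (c : ext_aff -> laurent),
    uniq u -> \sum_(x <- u) c x *: T x = 0 -> forall x, x \in u -> c x = 0;
  hecke_mul : forall x y : ext_aff,
    (ell x + ell y)%N = ell (x * y)%g -> T x * T y = T (x * y)%g;
  hecke_quad : forall s, s \in simple_refl ->
    (T s - v%:A) * (T s + vinv%:A) = 0 }.

Definition commutator_span (H : algType laurent) : set H :=
  [set h | exists u : seq (laurent * (H * H)),
    h = \sum_(p <- u) p.1 *: (p.2.1 * p.2.2 - p.2.2 * p.2.1)].

(* T_w = sum_O c_O T_O modulo [H, H], where T_O is the class of T_x for any
   element x of minimal length in O. *)
Definition class_expansion (H : algType laurent) (T : ext_aff -> H)
    (w : ext_aff) (c : set ext_aff -> laurent) : Prop :=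
  finite_set [set O | conj_classes O /\ c O != 0] /\
  forall rep : set ext_aff -> ext_aff,
    (forall O, conj_classes O -> min_length_in O (rep O)) ->
    commutator_span (T w - \sum_(O \in conj_classes) c O *: T (rep O)).

(* The class polynomial f_(w, O); meaningful only for O in [conj_classes]. *)
Definition class_poly (H : algType laurent) (T : ext_aff -> H)
    (w : ext_aff) (O : set ext_aff) : laurent :=
  xget (fun=> 0) [set c | class_expansion T w c] O.

Definition O_id : set ext_aff :=
  [set x | exists m n : int,
    x = (t (qvec m n) * tau)%g \/ x = (t (qvec m n) * s1 * s2 * tau)%g].

(* Used only for dominant lam in Q not of the form 2m alpha1 + m alpha2. *)
Definition O_dom (lam : coweight) : set ext_aff :=
  conj_class_of (t lam * s2 * s1 * tau)%g.

Definition O_refl (i : int) : set ext_aff :=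
  [set x | exists k : int,
    [\/ x = (t (qvec k i) * s1 * s2 * s1 * tau)%g,
        x = (t (qvec (k + i - 1) k) * s2 * tau)%g |
        x = (t (qvec (1 - i) k) * s1 * tau)%g]].

(* E'_(m alpha1 + n alpha2, tau); [divz] rounds down for a positive divisor. *)
Definition Eprime (m n : int) : set coweight :=
  [set qvec m k | k in [set k : int | ((m + 1) %/ 2)%Z + 1 <= k <= n]].

Lemma Eprime_index_set (j : nat) lam :
  Eprime j%:Z (2 * j%:Z - 1) lam ->
  dominant lam /\ ~ (exists2 m : int, 0 <= m & lam = qvec (2 * m) m).
Proof.
case=> k /= /andP[k_ge k_le] <-; split; first by rewrite /dominant qvecE /=; lia.
by case=> m m_ge; rewrite !qvecE => -[]; lia.
Qed.

Lemma trivIset_Eprime :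
  trivIset [set: nat] (fun j : nat => Eprime j%:Z (2 * j%:Z - 1)).
Proof.
move=> i j _ _ [lam [[k _ <-] [l _]]]; rewrite !qvecE => -[]; lia.
Qed.

(* Main.v *)
(* Existence. Conjugating by a simple reflection s gives, in the cocenter,
   T_x = T_{sxs} when the lengths agree and T_x = T_{sxs} + (v - 1/v) T_{sx}
   when the length drops by two. Three drops lead from
   w_k = t^(k alpha1 + 2k alpha2) tau to w_{k-1}; each of them leaves a
   reflection term. Two of these reflections have minimal length in the classes
   O_{2k} and O_{2k-1}; the third one descends to a minimal element of O_{1-k},
   each step leaving a translation, and these translations are the T_O for O in
   E'_{k alpha1 + (2k-1) alpha2}.

   Uniqueness. The T_O must be shown linearly independent in the cocenter.
   Twisted traces of modules induced from the Levi subgroups (the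
   one-dimensional module, a vector module on three particles, one of which is
   distinguished, and the module on three distinguishable particles) give
   linear forms vanishing on commutators. At v = 1 the Hecke algebra becomes
   the group algebra, and these forms separate, in a triangular way, the
   classes of rotations, reflections and translations. Hence the coefficients
   of a relation vanish at v = 1; dividing by v - 1 and iterating, they vanish. *)

Require Import Defs.
From HB Require Import structures.
From mathcomp Require Import all_boot all_order all_algebra all_fingroup.
From mathcomp Require Import boolp classical_sets functions cardinality fsbigop.
From mathcomp Require Import zify ring.

Set Implicit Arguments.
Unset Strict Implicit.
Unset Printing Implicit Defensive.

Import Order.TTheory GRing.Theory Num.Theory.

Local Open Scope classical_set_scope.
Local Open Scope ring_scope.

(** * The extended affine Weyl group in coordinates *)

(** [class_poly] selects an expansion by choice, so the reduction determines its value only together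
    with uniqueness. The algebra is any one with the given basis; forms on it are therefore
    prescribed on basis elements, and being a trace has to be proved. The modules are infinite over
    the Laurent ring, but their operators commute with shifts of the exponents. A single coefficient
    of the trace over the ring of shifts prescribes displacements, which is how infinitely many
    classes are told apart. At [v = 1] the operators permute the relevant states, so each such
    coefficient counts words that return up to a prescribed shift; no trace is computed for general
    [v]. The cocenter is not known to be torsion free, so a relation cannot be divided by [v - 1]
    there. It is first replaced by the relations among values of trace forms, which lie in a
    domain. *)

Variant weyl := W1 | Ws1 | Ws2 | Ws12 | Ws21 | Ws121.

Definition weyl_perm (g : weyl) : 'S_3 :=
  match g with
  | W1 => 1%g | Ws1 => w1 | Ws2 => w2
  | Ws12 => (w1 * w2)%g | Ws21 => (w2 * w1)%g | Ws121 => (w1 * w2 * w1)%g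
  end.

Definition lmul1 (g : weyl) : weyl :=
  match g with
  | W1 => Ws1 | Ws1 => W1 | Ws2 => Ws12
  | Ws12 => Ws2 | Ws21 => Ws121 | Ws121 => Ws21
  end.

Definition lmul2 (g : weyl) : weyl :=
  match g with
  | W1 => Ws2 | Ws1 => Ws21 | Ws2 => W1
  | Ws12 => Ws121 | Ws21 => Ws1 | Ws121 => Ws12
  end.

Definition weyl_mul (g h : weyl) : weyl :=
  match g with
  | W1 => h | Ws1 => lmul1 h | Ws2 => lmul2 h
  | Ws12 => lmul1 (lmul2 h) | Ws21 => lmul2 (lmul1 h)
  | Ws121 => lmul1 (lmul2 (lmul1 h))
  end.

Definition weyl_act (g : weyl) (p : int * int) : int * int :=
  let: (a, b) := p in
  match g with
  | W1 => (a, b) | Ws1 => (- a, a + b) | Ws2 => (a + b, - b)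
  | Ws12 => (- a - b, a) | Ws21 => (b, - a - b) | Ws121 => (- b, - a)
  end.

(** Permutations are replaced by an inductive type with six cases, so that group identities and
    length comparisons become integer arithmetic after case analysis. *)
Definition mk (a b : int) (g : weyl) : ext_aff := ExtAff (a, b) (weyl_perm g).

Lemma w1_sqr : (w1 * w1 = 1)%g. Proof. exact: tperm2. Qed.
Lemma w2_sqr : (w2 * w2 = 1)%g. Proof. exact: tperm2. Qed.

Lemma w1E : [/\ w1 i0 = i1, w1 i1 = i0 & w1 i2 = i2].
Proof. by rewrite /w1 tpermL tpermR tpermD. Qed.

Lemma w2E : [/\ w2 i0 = i0, w2 i1 = i2 & w2 i2 = i1].
Proof. by rewrite /w2 tpermL tpermR tpermD. Qed.

Lemma w_braid : (w1 * w2 * w1 = w2 * w1 * w2)%g.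
Proof.
have [a0 a1 a2] := w1E; have [b0 b1 b2] := w2E.
by apply/permP; elim/ord3P; rewrite !permM ?(a0, a1, a2, b0, b1, b2).
Qed.

Lemma lmul1E g : weyl_perm (lmul1 g) = (w1 * weyl_perm g)%g.
Proof. by case: g => /=; rewrite ?mulg1 ?mulgA ?w1_sqr ?mul1g. Qed.

Lemma lmul2E g : weyl_perm (lmul2 g) = (w2 * weyl_perm g)%g.
Proof.
case: g => //=; rewrite ?mulg1 ?mulgA ?w2_sqr ?mul1g //.
by rewrite -w_braid.
by rewrite -[in RHS]w_braid -mulgA w1_sqr mulg1.
Qed.

Lemma weyl_mulE g h : weyl_perm (weyl_mul g h) = (weyl_perm g * weyl_perm h)%g.
Proof. by case: g => /=; rewrite ?lmul1E ?lmul2E ?lmul1E ?mul1g ?mulgA. Qed.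

Lemma weyl_perm_inj : injective weyl_perm.
Proof.
have [a0 a1 a2] := w1E; have [b0 b1 b2] := w2E.
move=> g h /permP gh; move: (gh i0) (gh i1) (gh i2) => {gh}.
by case: g; case: h => //=;
  rewrite ?(permM, perm1) ?(permM, perm1, a0, a1, a2, b0, b1, b2).
Qed.

Lemma weyl_permP (w : 'S_3) : exists g, w = weyl_perm g.
Proof.
have [a0 a1 a2] := w1E; have [b0 b1 b2] := w2E.
have wi : injective w := @perm_inj _ w.
have n01 : w i0 != w i1 by rewrite (inj_eq wi).
have n02 : w i0 != w i2 by rewrite (inj_eq wi).
have n12 : w i1 != w i2 by rewrite (inj_eq wi).
have cmp g : w i0 = weyl_perm g i0 -> w i1 = weyl_perm g i1 ->
    w i2 = weyl_perm g i2 -> exists g, w = weyl_perm g.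
  by move=> e0 e1 e2; exists g; apply/permP; elim/ord3P.
move: n01 n02 n12.
have [c0 c1 c2] : [/\ w i0 \in [:: i0; i1; i2], w i1 \in [:: i0; i1; i2]
    & w i2 \in [:: i0; i1; i2]].
  by split; [elim/ord3P: (w i0)|elim/ord3P: (w i1)|elim/ord3P: (w i2)].
move: c0 c1 c2; rewrite !inE.
case/or3P=> /eqP e0; case/or3P=> /eqP e1; case/or3P=> /eqP e2;
  rewrite e0 e1 e2 // => _ _ _.
- by apply: (cmp W1); rewrite /= !perm1.
- by apply: (cmp Ws2); rewrite /= ?(b0, b1, b2).
- by apply: (cmp Ws1); rewrite /= ?(a0, a1, a2).
- by apply: (cmp Ws21); rewrite /= !permM ?(a0, a1, a2, b0, b1, b2).
- by apply: (cmp Ws12); rewrite /= !permM ?(a0, a1, a2, b0, b1, b2).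
- by apply: (cmp Ws121); rewrite /= !permM ?(a0, a1, a2, b0, b1, b2).
Qed.

Lemma mk_inj a b g c d h : mk a b g = mk c d h -> [/\ a = c, b = d & g = h].
Proof. by case=> -> -> /weyl_perm_inj. Qed.

Lemma mkP x : exists a b g, x = mk a b g.
Proof.
by case: x => -[a b] w; have [g ->] := weyl_permP w; exists a, b, g.
Qed.

Lemma wact_w1E p : wact w1 p = weyl_act Ws1 p.
Proof.
case: p => a b; have [a0 a1 a2] := w1E.
by rewrite /wact a0 a1 a2 /Defs.coord /=; congr pair; ring.
Qed.

Lemma wact_w2E p : wact w2 p = weyl_act Ws2 p.
Proof.
case: p => a b; have [a0 a1 a2] := w2E.
by rewrite /wact a0 a1 a2 /Defs.coord /=; congr pair; ring.
Qed.

Lemma weyl_actE g p : wact (weyl_perm g) p = weyl_act g p.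
Proof.
case: p => a b; case: g; rewrite /= ?wactM ?wact1 ?wact_w1E ?wact_w2E //=
  ?wact_w1E ?wact_w2E //=; congr pair; ring.
Qed.

Lemma mkM a b g c d h : (mk a b g * mk c d h)%g =
  mk (a + (weyl_act g (c, d)).1) (b + (weyl_act g (c, d)).2) (weyl_mul g h).
Proof.
rewrite -[LHS]/(ext_aff_mul _ _) /ext_aff_mul /mk /= weyl_actE weyl_mulE.
by case: g.
Qed.

Lemma mk1 : 1%g = mk 0 0 W1. Proof. by []. Qed.
Lemma s1E : s1 = mk 0 0 Ws1. Proof. by []. Qed.
Lemma s2E : s2 = mk 0 0 Ws2. Proof. by []. Qed.
Lemma tE a b : t (a, b) = mk a b W1. Proof. by []. Qed.

Lemma s0E : s0 = mk 1 1 Ws121.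
Proof. by rewrite /s0 s1E s2E (tE 1 1) !mkM /=; congr mk; ring. Qed.

Lemma tauE : tau = mk 1 0 Ws12.
Proof. by rewrite /tau s1E s2E (tE 1 0) !mkM /=; congr mk; ring. Qed.

Lemma tauXE : [/\ tau ^+ 0 = mk 0 0 W1, tau ^+ 1 = mk 1 0 Ws12,
  tau ^+ 2 = mk 0 1 Ws21 & tau ^+ 3 = mk 0 0 W1]%g.
Proof.
by split; rewrite ?expgS ?expg0 ?expg1 ?tauE mk1 ?mkM /=; congr mk; ring.
Qed.

Definition genE := (s0E, s1E, s2E, tauE).

Definition weyl_inv (g : weyl) : weyl :=
  match g with Ws12 => Ws21 | Ws21 => Ws12 | _ => g end.

Lemma mkV a b g : (mk a b g)^-1%g =
  mk (- (weyl_act (weyl_inv g) (a, b)).1) (- (weyl_act (weyl_inv g) (a, b)).2)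
     (weyl_inv g).
Proof.
apply: (mulgI (mk a b g)); rewrite mulgV mkM mk1.
by case: g => /=; congr mk; ring.
Qed.

(* The number of affine root hyperplanes separating the base alcove from its
   image. *)
Definition mklen (a b : int) (g : weyl) : nat :=
  match g with
  | W1 => absz a + absz b + absz (a + b)%R
  | Ws1 => absz (a - 1)%R + absz b + absz (a + b)%R
  | Ws2 => absz a + absz (b - 1)%R + absz (a + b)%R
  | Ws12 => absz (a - 1)%R + absz b + absz (a + b - 1)%R
  | Ws21 => absz a + absz (b - 1)%R + absz (a + b - 1)%R
  | Ws121 => absz (a - 1)%R + absz (b - 1)%R + absz (a + b - 1)%R
  end%N.

Lemma simple_reflP (x : ext_aff) :
  reflect [\/ x = s0, x = s1 | x = s2] (x \in simple_refl).
Proof.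
rewrite !inE; apply: (iffP or3P) => -[/eqP|/eqP|/eqP] ?.
all: by [apply: Or31 | apply: Or32 | apply: Or33].
Qed.

Lemma s0_simple : s0 \in simple_refl. Proof. by rewrite mem_head. Qed.
Lemma s1_simple : s1 \in simple_refl. Proof. by rewrite !inE eqxx orbT. Qed.
Lemma s2_simple : s2 \in simple_refl. Proof. by rewrite !inE eqxx !orbT. Qed.

Lemma simple_reflV (s : ext_aff) : s \in simple_refl -> (s * s = 1)%g.
Proof.
by case/simple_reflP=> ->; rewrite ?genE mkM mk1 /=; congr mk; ring.
Qed.

(** A simple reflection on the left changes [mklen] by at most one, and [mklen] vanishes on the
    powers of [tau]. *)
Lemma mklen_word u j a b g : {subset u <= simple_refl} ->
  ((\prod_(s <- u) s) * tau ^+ j)%g = mk a b g -> (mklen a b g <= size u)%N.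
Proof.
elim: u a b g => [|s u IHu] a b g us.
  have [t0 t1 t2 t3] := tauXE.
  rewrite big_nil mul1g (divn_eq j 3) mulnC expgnDr expgM t3 -mk1 expg1n mul1g.
  move: (j %% 3)%N (ltn_pmod j (isT : 0 < 3)%N) => [|[|[|//]]] _;
    by rewrite ?t0 ?t1 ?t2 => /mk_inj[<- <- <-].
have ss : s \in simple_refl by rewrite us ?mem_head.
rewrite big_cons -mulgA => /(canRL (mulKg s)).
have -> : (s^-1 = s)%g by apply: (mulgI s); rewrite mulgV simple_reflV.
case/simple_reflP: ss => ->; rewrite ?(s0E, s1E, s2E) mkM => /IHu le_u;
  (have /le_u : {subset u <= simple_refl}
    by move=> x xu; apply: us; rewrite inE xu orbT);
  by case: g {le_u} => /=; lia.
Qed.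

Lemma has_word_mklen n a b g : mklen a b g = n -> has_word (mk a b g) n.
Proof.
elim: n a b g => [|n IHn] a b g; last first.
  have step c d h s : s \in simple_refl -> (s * mk a b g)%g = mk c d h ->
      mklen c d h = n -> has_word (mk a b g) n.+1.
    move=> ss sx /IHn[u [j [us szu e]]]; exists (s :: u), j; split.
    - by move=> y; rewrite inE => /predU1P[->//|/us].
    - by rewrite /= szu.
    - by rewrite big_cons -mulgA -e -sx mulgA simple_reflV ?mul1g.
  move=> len.
  have [e|[e|e]] : mklen (1 - b) (1 - a) (weyl_mul Ws121 g) = n \/
     mklen (- a) (a + b) (lmul1 g) = n \/ mklen (a + b) (- b) (lmul2 g) = n.
    by clear step; case: g len => /= len; lia.
  - apply: (step _ _ _ _ s0_simple _ e); rewrite s0E mkM.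
    by clear step len e; case: g => /=; congr mk; ring.
  - apply: (step _ _ _ _ s1_simple _ e); rewrite s1E mkM.
    by clear step len e; case: g => /=; congr mk; ring.
  - apply: (step _ _ _ _ s2_simple _ e); rewrite s2E mkM.
    by clear step len e; case: g => /=; congr mk; ring.
have tau_word j c d h : (tau ^+ j)%g = mk c d h -> has_word (mk c d h) 0.
  by move=> <-; exists [::], j; rewrite big_nil mul1g.
have [t0 t1 t2 _] := tauXE.
move=> len.
have [[-> -> ->]|[-> -> ->]|[-> -> ->]] : [\/ [/\ a = 0, b = 0 & g = W1],
    [/\ a = 1, b = 0 & g = Ws12] | [/\ a = 0, b = 1 & g = Ws21]].
  by case: g len => /= len; (try lia);
    [apply: Or31 | apply: Or32 | apply: Or33]; split=> //; lia.
- exact: tau_word t0.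
- exact: tau_word t1.
- exact: tau_word t2.
Qed.

Lemma ellE a b g : ell (mk a b g) = mklen a b g.
Proof.
have Pn : has_word (mk a b g) (mklen a b g) /\
    forall m, has_word (mk a b g) m -> (mklen a b g <= m)%N.
  split; first exact: has_word_mklen.
  by move=> _ [u [j [us <- /esym e]]]; apply: mklen_word e.
rewrite /ell; case: xgetP => [n -> [wn le_n]|/(_ (mklen a b g))[]//].
by apply/eqP; rewrite eqn_leq le_n ?Pn.2 //; exact: Pn.1.
Qed.

Lemma ell_tau_l (x : ext_aff) : ell (tau * x)%g = ell x.
Proof.
have [a [b [g ->]]] := mkP x.
by rewrite tauE mkM !ellE; case: g => /=; lia.
Qed.

Lemma ell_tau_r (x : ext_aff) : ell (x * tau)%g = ell x.
Proof.
have [a [b [g ->]]] := mkP x.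
by rewrite tauE mkM !ellE; case: g => /=; lia.
Qed.

Lemma ell_tauX j : ell (tau ^+ j)%g = 0%N.
Proof.
elim: j => [|j IHj]; last by rewrite expgS ell_tau_l.
by rewrite expg0 mk1 ellE.
Qed.

Lemma ell_one : ell 1%g = 0%N. Proof. exact: (ell_tauX 0). Qed.

Lemma ell_simple_l (s x : ext_aff) : s \in simple_refl ->
  ell (s * x)%g = (ell x).+1 \/ ell x = (ell (s * x)%g).+1.
Proof.
have [a [b [g ->]]] := mkP x.
case/simple_reflP=> ->; rewrite genE mkM !ellE; case: g => /=; lia.
Qed.

Lemma ell_simple_r (s x : ext_aff) : s \in simple_refl ->
  ell (x * s)%g = (ell x).+1 \/ ell x = (ell (x * s)%g).+1.
Proof.
have [a [b [g ->]]] := mkP x.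
case/simple_reflP=> ->; rewrite genE mkM !ellE; case: g => /=; lia.
Qed.

Lemma ell_simple (s : ext_aff) : s \in simple_refl -> ell s = 1%N.
Proof. by case/simple_reflP=> ->; rewrite genE ellE. Qed.

Lemma ell_eq0 (x : ext_aff) :
  ell x = 0%N -> exists2 j, (j < 3)%N & x = (tau ^+ j)%g.
Proof.
have [a [b [g ->]]] := mkP x; rewrite ellE => len.
have [t0 t1 t2 _] := tauXE.
have [[-> [-> ->]]|[[-> [-> ->]]|[-> [-> ->]]]] :
    (a = 0 /\ b = 0 /\ g = W1) \/ (a = 1 /\ b = 0 /\ g = Ws12) \/
    (a = 0 /\ b = 1 /\ g = Ws21).
- case: g len => /= len; (try lia);
    [left | right; left | right; right]; by do !split => //; lia.
- by exists 0%N; rewrite ?t0.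
- by exists 1%N; rewrite ?t1.
- by exists 2; rewrite ?t2.
Qed.

Lemma ell_descent (x : ext_aff) : (0 < ell x)%N ->
  exists2 s : ext_aff, s \in simple_refl & ell x = (ell (s * x)%g).+1.
Proof.
have [a [b [g ->]]] := mkP x; rewrite ellE => len.
have [e|[e|e]] : mklen a b g = (ell (s0 * mk a b g)%g).+1 \/
    mklen a b g = (ell (s1 * mk a b g)%g).+1 \/
    mklen a b g = (ell (s2 * mk a b g)%g).+1.
  rewrite !genE !mkM !ellE; case: g len => /=; lia.
- by exists s0; rewrite ?s0_simple.
- by exists s1; rewrite ?s1_simple.
- by exists s2; rewrite ?s2_simple.
Qed.

Lemma simple_braid (s r : ext_aff) :
  s \in simple_refl -> r \in simple_refl -> s != r ->
  (s * r * s = r * s * r)%g.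
Proof.
case/simple_reflP=> ->; case/simple_reflP=> ->; rewrite ?eqxx // => _;
  rewrite !genE !mkM /=; congr mk; ring.
Qed.

(* Two distinct left descents generate a finite parabolic subgroup of type
   A_2, whose longest element is then a reduced left factor. *)
Lemma descents_braid (s r x : ext_aff) : s \in simple_refl -> r \in simple_refl ->
  s != r -> ell x = (ell (s * x)%g).+1 -> ell x = (ell (r * x)%g).+1 ->
  ell (s * x)%g = (ell (r * (s * x))%g).+1 /\
  ell (r * (s * x))%g = (ell (s * (r * (s * x)))%g).+1.
Proof.
have [a [b [g ->]]] := mkP x.
case/simple_reflP=> ->; case/simple_reflP=> ->; rewrite ?eqxx // => _;
  rewrite !genE !mkM !ellE; case: g => /=; lia.
Qed.

(** * The Hecke algebra and its cocenter *)

Lemma tau_conj_s1 : (tau * s1 * tau ^+ 2 = s2)%g.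
Proof.
have [_ _ -> _] := tauXE.
by rewrite !genE !mkM /=; congr mk; ring.
Qed.

Lemma tau_conj_s1V : (tau ^+ 2 * s1 * tau = s0)%g.
Proof.
have [_ _ -> _] := tauXE.
by rewrite !genE !mkM /=; congr mk; ring.
Qed.

Section Hecke.

Variables (H : algType laurent) (T : ext_aff -> H).
Hypothesis hH : is_hecke_algebra T.

Local Notation ep := (v - vinv).

(** [T 1] is a left unit on every basis element, hence on the expansion of the unit of [H]. *)
Lemma hecke_one : T 1%g = 1.
Proof.
have T1l x : T 1%g * T x = T x by rewrite (hecke_mul hH) mul1g // ell_one.
have [u [c e]] := hecke_span hH 1.
rewrite -[LHS]mulr1 [in LHS]e [RHS]e mulr_sumr.
by apply: eq_bigr => x _; rewrite -scalerAr T1l.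
Qed.

Lemma hecke_sqr (s : ext_aff) : s \in simple_refl -> T s * T s = 1 + ep *: T s.
Proof.
move=> /(hecke_quad hH); rewrite mulrDr !mulrBl -!scalerAl !mul1r.
rewrite -!scalerAr !mulr1 scalerA mulvV scale1r => e.
apply/eqP; rewrite -subr_eq0; apply/eqP; rewrite -[RHS]e scalerBl.
rewrite opprD opprB -[in RHS]addrA; congr (_ + _); rewrite addrA addrC.
by rewrite [-1 + _]addrC.
Qed.

Lemma hecke_up_l (s x : ext_aff) :
  s \in simple_refl -> ell (s * x)%g = (ell x).+1 ->
  T s * T x = T (s * x)%g.
Proof. by move=> ss e; apply: (hecke_mul hH); rewrite ell_simple ?e. Qed.

Lemma hecke_up_r (s x : ext_aff) :
  s \in simple_refl -> ell (x * s)%g = (ell x).+1 ->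
  T x * T s = T (x * s)%g.
Proof.
by move=> ss e; apply: (hecke_mul hH); rewrite (ell_simple ss) e addn1.
Qed.

Lemma hecke_down_l (s x : ext_aff) :
  s \in simple_refl -> ell x = (ell (s * x)%g).+1 ->
  T s * T x = T (s * x)%g + ep *: T x.
Proof.
move=> ss e; have sx : (s * (s * x) = x)%g by rewrite mulgA simple_reflV ?mul1g.
have Tx : T s * T (s * x)%g = T x by rewrite hecke_up_l ?sx.
by rewrite -[in LHS]Tx mulrA hecke_sqr // mulrDl mul1r -scalerAl Tx.
Qed.

Lemma hecke_down_r (s x : ext_aff) :
  s \in simple_refl -> ell x = (ell (x * s)%g).+1 ->
  T x * T s = T (x * s)%g + ep *: T x.
Proof.
move=> ss e; have xs : (x * s * s = x)%g by rewrite -mulgA simple_reflV ?mulg1.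
have Tx : T (x * s)%g * T s = T x by rewrite hecke_up_r ?xs.
by rewrite -[in LHS]Tx -mulrA hecke_sqr // mulrDr mulr1 -scalerAr Tx.
Qed.

Lemma hecke_tau_l (x : ext_aff) : T tau * T x = T (tau * x)%g.
Proof. by apply: (hecke_mul hH); rewrite ell_tau_l (ell_tauX 1). Qed.

Lemma hecke_tau_r (x : ext_aff) : T x * T tau = T (x * tau)%g.
Proof. by apply: (hecke_mul hH); rewrite ell_tau_r (ell_tauX 1) addn0. Qed.

Definition cocenter_eq (h g : H) : Prop := commutator_span (h - g).

Lemma commutator_span0 : commutator_span (0 : H).
Proof. by exists [::]; rewrite big_nil. Qed.

Lemma commutator_spanD (h g : H) :
  commutator_span h -> commutator_span g -> commutator_span (h + g).
Proof. by case=> u -> [w ->]; exists (u ++ w); rewrite big_cat. Qed.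

Lemma commutator_spanZ a (h : H) : commutator_span h -> commutator_span (a *: h).
Proof.
case=> u ->; exists [seq (a * p.1, p.2) | p <- u].
by rewrite big_map scaler_sumr; apply: eq_bigr => p _; rewrite /= scalerA.
Qed.

Lemma commutator_spanN (h : H) : commutator_span h -> commutator_span (- h).
Proof. by rewrite -scaleN1r; apply: commutator_spanZ. Qed.

Lemma cocenter_eq_refl h : cocenter_eq h h.
Proof. by rewrite /cocenter_eq subrr; apply: commutator_span0. Qed.

Lemma cocenter_eq_sym h g : cocenter_eq h g -> cocenter_eq g h.
Proof. by move/commutator_spanN; rewrite opprB. Qed.

Lemma cocenter_eq_trans h g k :
  cocenter_eq h g -> cocenter_eq g k -> cocenter_eq h k.
Proof. by move=> hg /(commutator_spanD hg); rewrite addrA subrK. Qed.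

Lemma cocenter_eqD h g h' g' : cocenter_eq h g -> cocenter_eq h' g' ->
  cocenter_eq (h + h') (g + g').
Proof.
move=> hg /(commutator_spanD hg); rewrite /cocenter_eq opprD addrACA.
by rewrite addrACA.
Qed.

Lemma cocenter_eqZ a h g : cocenter_eq h g -> cocenter_eq (a *: h) (a *: g).
Proof. by move/(commutator_spanZ a); rewrite scalerBr. Qed.

Lemma cocenter_eq_sum (I : eqType) (r : seq I) (F G : I -> H) :
  (forall i, i \in r -> cocenter_eq (F i) (G i)) ->
  cocenter_eq (\sum_(i <- r) F i) (\sum_(i <- r) G i).
Proof.
elim: r => [|i r IHr] FG; first by rewrite !big_nil; apply: cocenter_eq_refl.
rewrite !big_cons; apply: cocenter_eqD; first by apply: FG; rewrite mem_head.
by apply: IHr => j jr; apply: FG; rewrite inE jr orbT.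
Qed.

Lemma cocenter_eq_mulC h g : cocenter_eq (h * g) (g * h).
Proof. by exists [:: (1, (h, g))]; rewrite big_seq1 scale1r. Qed.

Lemma cocenter_eq_conj a b h g : b * a = 1 -> a * b = 1 -> g * a = a * h ->
  cocenter_eq g h.
Proof.
move=> ba ab ga; have -> : g = a * h * b by rewrite -ga -mulrA ab mulr1.
by have := cocenter_eq_mulC (a * h) b; rewrite mulrA ba mul1r.
Qed.

(** If [s] lengthens [x], then [T (s * x * s) * T s] and [T s * T x] both equal [T (s * x)], and
    [T s] is invertible with inverse [T s - ep]. Otherwise the two elements are the two products of
    [T s] and [T (s * x)]. *)
Lemma cocenter_eq_same_length (s x : ext_aff) : s \in simple_refl ->
  ell (s * x * s)%g = ell x -> cocenter_eq (T (s * x * s)%g) (T x).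
Proof.
move=> ss e.
have xss : (s * x * s * s = s * x)%g by rewrite -mulgA simple_reflV ?mulg1.
have [up|down] := ell_simple_l x ss.
- apply: (@cocenter_eq_conj (T s) (T s - ep%:A)).
  + by rewrite mulrBl hecke_sqr // -scalerAl mul1r addrK.
  + by rewrite mulrBr hecke_sqr // -scalerAr mulr1 addrK.
  + by rewrite hecke_up_r ?hecke_up_l ?xss ?e.
- have := cocenter_eq_mulC (T (s * x)%g) (T s).
  have sxs : (s * (s * x) = x)%g by rewrite mulgA simple_reflV ?mul1g.
  by rewrite hecke_up_r ?e // hecke_up_l ?sxs.
Qed.

(** [T x] is [T s * T (s * x)]; in the opposite product [s] is a right descent, and the quadratic
    relation produces the second term. *)
Lemma cocenter_eq_shorter (s x : ext_aff) : s \in simple_refl ->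
  ell x = (ell (s * x * s)%g).+2 ->
  cocenter_eq (T x) (T (s * x * s)%g + ep *: T (s * x)%g).
Proof.
move=> ss e.
have [e1 e2] : ell x = (ell (s * x)%g).+1 /\
    ell (s * x)%g = (ell (s * x * s)%g).+1.
  by case: (ell_simple_l x ss) (ell_simple_r (s * x)%g ss); lia.
have sxs : (s * (s * x) = x)%g by rewrite mulgA simple_reflV ?mul1g.
have := cocenter_eq_mulC (T s) (T (s * x)%g).
by rewrite hecke_up_l ?sxs // hecke_down_r.
Qed.

Lemma cocenter_eq_tau (x : ext_aff) : cocenter_eq (T (tau * x * tau^-1)%g) (T x).
Proof.
apply: (@cocenter_eq_conj (T tau) (T tau^-1%g)).
- by rewrite hecke_tau_r mulVg hecke_one.
- by rewrite hecke_tau_l mulgV hecke_one.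
- by rewrite hecke_tau_r hecke_tau_l mulgVK.
Qed.

(** Freeness concerns lists without repetition, so equal basis elements are grouped first, once in
    [H] and once in the scalars. *)
Lemma linear_extension_wd (phi : ext_aff -> laurent)
    (l : seq (laurent * ext_aff)) :
  \sum_(p <- l) p.1 *: T p.2 = 0 -> \sum_(p <- l) p.1 * phi p.2 = 0.
Proof.
pose c x := \sum_(p <- l | p.2 == x) p.1.
pose xs := undup [seq p.2 | p <- l].
have group (V : lmodType laurent) (F : ext_aff -> V) :
    \sum_(p <- l) p.1 *: F p.2 = \sum_(x <- xs) c x *: F x.
  rewrite [RHS](eq_bigr
    (fun x => \sum_(p <- l) if p.2 == x then p.1 *: F p.2 else 0)).
    rewrite exchange_big /= big_seq [RHS]big_seq; apply: eq_bigr => p pl.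
    rewrite (bigD1_seq p.2) ?undup_uniq ?eqxx ?mem_undup ?map_f //=.
    by rewrite big1 ?addr0 // => x /negPf; rewrite eq_sym => ->.
  move=> x _; rewrite /c scaler_suml -big_mkcond /=.
  by apply: eq_bigr => p /eqP ->.
rewrite group => /(hecke_free hH) c0; have := group laurent^o phi => /= ->.
by rewrite big_seq big1 // => x xs_x; rewrite c0 ?undup_uniq ?scale0r.
Qed.

Lemma linear_extension (phi : ext_aff -> laurent) :
  exists F : H -> laurent, linear_for *%R F /\ forall x, F (T x) = phi x.
Proof.
have sp (h : H) : exists l : seq (laurent * ext_aff),
    h = \sum_(p <- l) p.1 *: T p.2.
  have [u [c ->]] := hecke_span hH h.
  by exists [seq (c x, x) | x <- u]; rewrite big_map.
have [f fE] := choice sp.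
pose F h := \sum_(p <- f h) p.1 * phi p.2.
have FE l h : h = \sum_(p <- l) p.1 *: T p.2 -> F h = \sum_(p <- l) p.1 * phi p.2.
  move=> e; apply/eqP; rewrite -subr_eq0; apply/eqP.
  pose l' := f h ++ [seq (- p.1, p.2) | p <- l].
  have : \sum_(p <- l') p.1 *: T p.2 = 0.
    rewrite big_cat big_map /= -fE (eq_bigr (fun p => - (p.1 *: T p.2))).
      by rewrite sumrN -e subrr.
    by move=> p _; rewrite scaleNr.
  move/(linear_extension_wd phi) => l0; rewrite -[RHS]l0.
  rewrite big_cat big_map /= -sumrN; congr (_ + _).
  by apply: eq_bigr => p _; rewrite mulNr.
exists F; split=> [a h g|x]; last first.
  by rewrite (FE [:: (1, x)]) big_seq1 ?scale1r ?mul1r.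
rewrite (FE ([seq (a * p.1, p.2) | p <- f h] ++ f g)).
  rewrite big_cat big_map /=; congr (_ + _); rewrite mulr_sumr.
  by apply: eq_bigr => p _; rewrite mulrA.
rewrite big_cat big_map /= -fE [in LHS](fE h) scaler_sumr; congr (_ + _).
by apply: eq_bigr => p _; rewrite scalerA.
Qed.

End Hecke.

Lemma ell_mul_le (x y : ext_aff) : (ell (x * y)%g <= ell x + ell y)%N.
Proof.
move: {2}(ell x) (leqnn (ell x)) => n; elim: n x => [|n IHn] x le_n.
  have [|j _ ->] := @ell_eq0 x; first by lia.
  elim: j => [|j IHj]; first by rewrite expg0 mul1g leq_addl.
  by rewrite expgS -mulgA !ell_tau_l.
have [x0|x_gt0] := posnP (ell x); first by apply: IHn; rewrite x0.
have [s ss e] := ell_descent x_gt0.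
have : (ell (s * (x * y))%g <= ell (s * x)%g + ell y)%N.
  have -> : (s * (x * y) = s * x * y)%g by rewrite mulgA.
  by apply: IHn; lia.
by case: (ell_simple_l (x * y)%g ss); lia.
Qed.

Section Trace.

Variables (H : algType laurent) (T : ext_aff -> H).
Hypothesis hH : is_hecke_algebra T.
Variable F : H -> laurent.
Hypothesis F_lin : linear_for *%R F.

Lemma linear_forD h g : F (h + g) = F h + F g.
Proof. by rewrite -[h]scale1r F_lin mul1r scale1r. Qed.

Lemma linear_for0 : F 0 = 0.
Proof. by apply: (addrI (F 0)); rewrite -linear_forD !addr0. Qed.

Lemma linear_forZ a h : F (a *: h) = a * F h.
Proof. by rewrite -[a *: h]addr0 F_lin linear_for0 addr0. Qed.

Lemma linear_forB h g : F (h - g) = F h - F g.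
Proof. by rewrite linear_forD -scaleN1r linear_forZ mulN1r. Qed.

Lemma linear_for_sum (I : Type) (r : seq I) (P : pred I) (G : I -> H) :
  F (\sum_(i <- r | P i) G i) = \sum_(i <- r | P i) F (G i).
Proof. exact: (big_morph F linear_forD linear_for0). Qed.

Hypothesis F_s1 : forall x, F (T s1 * T x) = F (T x * T s1).
Hypothesis F_tau : forall x, F (T tau * T x) = F (T x * T tau).

(** The elements [h] satisfying the trace identity against every [g] are closed under products, and
    [T s1] and [T tau] generate the other [T s]; checking these two is enough. *)
Lemma hecke_trace h g : F (h * g) = F (g * h).
Proof.
pose C (h : H) := forall g, F (h * g) = F (g * h).
have CM a b : C a -> C b -> C (a * b).
  by move=> Ca Cb k; rewrite -mulrA Ca -mulrA Cb mulrA.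
have CT x : (forall y, F (T x * T y) = F (T y * T x)) -> C (T x).
  move=> e k; have [u [c ->]] := hecke_span hH k.
  rewrite mulr_sumr mulr_suml !linear_for_sum; apply: eq_bigr => y _.
  by rewrite -scalerAl -scalerAr !linear_forZ e.
have C1 : C (T s1) by apply: CT.
have Ct : C (T tau) by apply: CT.
have Ct2 : C (T (tau ^+ 2)%g).
  by rewrite expgS expg1 -(hecke_tau_l hH); apply: CM.
have C2 : C (T s2).
  have -> : T s2 = T tau * T s1 * T (tau ^+ 2)%g; last first.
    exact: CM (CM _ _ Ct C1) Ct2.
  by rewrite (hecke_tau_l hH) (hecke_mul hH) ?tau_conj_s1 // ell_tauX ell_tau_l
    !ell_simple ?s1_simple ?s2_simple.
have C0 : C (T s0).
  have -> : T s0 = T (tau ^+ 2)%g * T s1 * T tau; last first.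
    exact: CM (CM _ _ Ct2 C1) Ct.
  have -> : T (tau ^+ 2)%g * T s1 = T (tau ^+ 2 * s1)%g.
    apply: (hecke_mul hH); rewrite ell_tauX (expgS tau 1) expg1 -mulgA.
    by rewrite !ell_tau_l.
  by rewrite (hecke_tau_r hH) tau_conj_s1V.
have Cs s : s \in simple_refl -> C (T s) by case/simple_reflP=> ->.
have CT' x : C (T x).
  move: {2}(ell x) (leqnn (ell x)) => n; elim: n x => [|n IHn] x le_n.
    have [|j _ ->] := @ell_eq0 x; first by lia.
    elim: j => [|j IHj]; last by rewrite expgS -(hecke_tau_l hH); apply: CM.
    by move=> k; rewrite expg0 (hecke_one hH) mulr1 mul1r.
  have [x0|x_gt0] := posnP (ell x); first by apply: IHn; rewrite x0.
  have [s ss e] := ell_descent x_gt0.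
  have sx : (s * (s * x) = x)%g by rewrite mulgA simple_reflV ?mul1g.
  rewrite -sx -(hecke_up_l hH) ?sx //; apply: CM; first exact: Cs.
  by apply: IHn; lia.
have [u [c ->]] := hecke_span hH h.
rewrite mulr_sumr mulr_suml !linear_for_sum; apply: eq_bigr => y _.
by rewrite -scalerAl -scalerAr !linear_forZ CT'.
Qed.

Lemma trace_commutator_span h : commutator_span h -> F h = 0.
Proof.
case=> u ->; rewrite linear_for_sum big1 // => p _.
by rewrite linear_forZ linear_forB hecke_trace subrr mulr0.
Qed.

End Trace.

(** * Modules of particles *)

(* Three particles sit at the positions 0, 1, 2 of a circle; a particle has a
   label and an exponent recording its displacement (the power of the formal
   parameter attached to its label). Label 2 is not tracked, so that particles
   of label 2 with exponent 0 are indistinguishable. *)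
Definition particle : Type := (nat * int)%type.
Definition state : Type := (particle * particle * particle)%type.

Definition wt (l : nat) : int := (l < 2)%N%:Z.
Definition move_by (d : int) (p : particle) : particle := (p.1, p.2 + wt p.1 * d).
Definition swap01 (x : state) : state :=
  let: (p, q, r) := x in (move_by (-1) q, move_by 1 p, r).
Definition turn (x : state) : state := let: (p, q, r) := x in (q, r, p).
Definition turnV (x : state) : state := let: (p, q, r) := x in (r, p, q).

(* The generator s1 acts on positions 0 and 1 as in the regular module of the
   Hecke algebra of type A_1, or by the scalar v when the labels coincide; the
   actions of s2 and s0 are obtained by conjugating with tau. *)
Definition R1 (f : state -> laurent) (x : state) : laurent :=
  let: (p, q, r) := x in
  if p.1 == q.1 then v * f x
  else f (swap01 x) + (if (q.1 < p.1)%N then (v - vinv) * f x else 0).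
Definition Rt (f : state -> laurent) (x : state) : laurent := f (turn x).
Definition RtV (f : state -> laurent) (x : state) : laurent := f (turnV x).
Definition R2 f := Rt (R1 (RtV f)).
Definition R0 f := RtV (R1 (Rt f)).

Lemma turnK : cancel turn turnV. Proof. by case=> -[]. Qed.
Lemma turnVK : cancel turnV turn. Proof. by case=> -[]. Qed.
Lemma RtK f : RtV (Rt f) = f. Proof. by apply/funext => -[[]]. Qed.
Lemma RtVK f : Rt (RtV f) = f. Proof. by apply/funext => -[[]]. Qed.
Lemma Rt2 f : Rt (Rt f) = RtV f. Proof. by apply/funext => -[[]]. Qed.
Lemma RtV2 f : RtV (RtV f) = Rt f. Proof. by apply/funext => -[[]]. Qed.

Lemma move_by0 p : move_by 0 p = p.
Proof. by case: p => l x; rewrite /move_by /= mulr0 addr0. Qed.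
Lemma move_byD c d p : move_by c (move_by d p) = move_by (c + d) p.
Proof. by case: p => l x; rewrite /move_by /=; congr pair; ring. Qed.

Lemma swap01K : involutive swap01.
Proof. by case=> -[p q] r; rewrite /= !move_byD !move_by0. Qed.

Lemma v_sqr : v * v = 1 + (v - vinv) * v.
Proof. by rewrite mulrBl [vinv * v]mulrC mulvV addrC subrK. Qed.

Lemma R1_sqr f x : R1 (R1 f) x = f x + (v - vinv) * R1 f x.
Proof.
case: x => -[[a x] [b y]] [c z]; rewrite /R1 /=.
have [->|ab] := eqVneq a b.
  by rewrite mulrA v_sqr mulrDl mul1r -mulrA.
move: (v - vinv) => e.
rewrite /move_by /= !mulr1 !mulrN1 subrK addrK.
by have [lt_ab|lt_ba|e_ab] := ltngtP a b; [ring|ring|rewrite e_ab eqxx in ab].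
Qed.

Lemma R12_braid f : R1 (R2 (R1 f)) = R2 (R1 (R2 f)).
Proof.
apply/funext => -[[[a x] [b y]] [c z]].
rewrite /R2 /Rt /RtV /R1 /= /move_by /=.
(* With [v - vinv] abstracted, [v * v = 1 + e * v] is the only relation left between the scalars. *)
have vv := v_sqr; move: (v - vinv) vv => e vv.
have [ab|ba|ab] := ltngtP a b; have [bc|cb|bc] := ltngtP b c;
  have [ac|ca|ac] := ltngtP a c; try lia; subst; rewrite /= ?eqxx ?ltnn.
all: rewrite ?(mulr1, mulrN1, subrK, addrK); try by ring.
(* Both remaining cases have exactly two equal labels, and the sides differ by a multiple of the
   quadratic relation. *)
- apply: subr0_eq; set F := f (a, x, (c, y), (c, z)).
  transitivity (e * F * (1 + e * v - v * v)); first by ring.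
  by rewrite -vv subrr mulr0.
- apply: subr0_eq; set F := f (b, x, (b, y), (c, z)).
  transitivity (e * F * (v * v - (1 + e * v))); first by ring.
  by rewrite -vv subrr mulr0.
Qed.

(** * The action of the Hecke basis on functions of states *)

Definition hact_gen (s : ext_aff) (f : state -> laurent) : state -> laurent :=
  if s == s1 then R1 f else if s == s2 then R2 f else R0 f.

Definition first_descent (x : ext_aff) : ext_aff :=
  if (ell (s0 * x)%g < ell x)%N then s0
  else if (ell (s1 * x)%g < ell x)%N then s1 else s2.

Definition hact_tau_power (x : ext_aff) (f : state -> laurent) :
  state -> laurent :=
  if x == tau then Rt f else if x == (tau ^+ 2)%g then RtV f else f.

Fixpoint hact_rec (n : nat) (x : ext_aff) (f : state -> laurent) :=
  if n is n'.+1 then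
    hact_gen (first_descent x) (hact_rec n' (first_descent x * x)%g f)
  else hact_tau_power x f.

Definition hact (x : ext_aff) (f : state -> laurent) := hact_rec (ell x) x f.

Lemma hact_gens f : [/\ hact_gen s0 f = R0 f, hact_gen s1 f = R1 f
  & hact_gen s2 f = R2 f].
Proof.
have n10 : s0 != s1 by apply/eqP; rewrite s0E s1E => /mk_inj[].
have n20 : s0 != s2 by apply/eqP; rewrite s0E s2E => /mk_inj[].
have n12 : s2 != s1 by apply/eqP; rewrite s2E s1E => /mk_inj[].
by rewrite /hact_gen !eqxx (negPf n10) (negPf n20) (negPf n12).
Qed.

Lemma hact_gen_tau f : [/\ Rt (hact_gen s0 f) = hact_gen s1 (Rt f),
  Rt (hact_gen s1 f) = hact_gen s2 (Rt f)
  & Rt (hact_gen s2 f) = hact_gen s0 (Rt f)].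
Proof.
have [-> -> ->] := hact_gens f; have [-> -> ->] := hact_gens (Rt f).
by rewrite /R0 /R2 RtVK RtK -RtV2 RtVK Rt2.
Qed.

(** Conjugation by [Rt] permutes the three operators cyclically and carries the relation for one
    pair to the others. *)
Lemma hact_gen_braid (s r : ext_aff) f : s \in simple_refl -> r \in simple_refl ->
  hact_gen s (hact_gen r (hact_gen s f)) = hact_gen r (hact_gen s (hact_gen r f)).
Proof.
pose B s r := forall f, hact_gen s (hact_gen r (hact_gen s f)) =
  hact_gen r (hact_gen s (hact_gen r f)).
have B12 : B s1 s2.
  move=> g; have E h := hact_gens h.
  have E1 h : hact_gen s1 h = R1 h by case: (E h).
  have E2 h : hact_gen s2 h = R2 h by case: (E h).
  by rewrite !E1 !E2 R12_braid.
have RtI g h : Rt g = Rt h -> g = h by move/(congr1 RtV); rewrite !RtK.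
have t0 h : Rt (hact_gen s0 h) = hact_gen s1 (Rt h) by case: (hact_gen_tau h).
have t1 h : Rt (hact_gen s1 h) = hact_gen s2 (Rt h) by case: (hact_gen_tau h).
have t2 h : Rt (hact_gen s2 h) = hact_gen s0 (Rt h) by case: (hact_gen_tau h).
have B01 : B s0 s1 by move=> g; apply: RtI; rewrite !(t0, t1, t2) B12.
have B20 : B s2 s0 by move=> g; apply: RtI; rewrite !(t0, t1, t2) B01.
case/simple_reflP=> ->; case/simple_reflP=> ->.
- by [].
- exact: B01.
- exact/esym/B20.
- exact/esym/B01.
- by [].
- exact: B12.
- exact: B20.
- exact/esym/B12.
- by [].
Qed.

Lemma first_descentP (x : ext_aff) : (0 < ell x)%N ->
  first_descent x \in simple_refl /\
  ell x = (ell (first_descent x * x)%g).+1.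
Proof.
move=> x_gt0; have [s ss e] := ell_descent x_gt0.
have down (r : ext_aff) : r \in simple_refl -> (ell (r * x)%g < ell x)%N ->
    r \in simple_refl /\ ell x = (ell (r * x)%g).+1.
  by move=> rs lt; split=> //; case: (ell_simple_l x rs) lt; lia.
rewrite /first_descent; case: ifP => [lt0|n0]; first exact: down s0_simple lt0.
case: ifP => [lt1|n1]; first exact: down s1_simple lt1.
apply: down s2_simple _; case/simple_reflP: ss e => -> e //.
- by rewrite e ltnSn in n0.
- by rewrite e ltnSn in n1.
- by rewrite e.
Qed.

(* This is Matsumoto's theorem for the operators: the chosen descent does not
   matter, by the braid relations. *)
Lemma hact_step (x s : ext_aff) f :
  s \in simple_refl -> ell x = (ell (s * x)%g).+1 ->
  hact x f = hact_gen s (hact (s * x)%g f).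
Proof.
move: {2}(ell x) (leqnn (ell x)) => n.
elim/ltn_ind: n x s f => n IHn x s f le_n ss es.
have [rs er] : first_descent x \in simple_refl /\
  ell x = (ell (first_descent x * x)%g).+1 by apply: first_descentP; rewrite es.
have actx : hact x f =
    hact_gen (first_descent x) (hact (first_descent x * x)%g f).
  by rewrite {1}/hact er /=.
have [<-//|ne] := eqVneq (first_descent x) s.
rewrite actx; move: (first_descent x) rs er ne => r rs er ne {actx}.
have [e1 e2] := descents_braid rs ss ne er es.
have [e3 e4] : ell (s * x)%g = (ell (r * (s * x))%g).+1 /\
    ell (r * (s * x))%g = (ell (s * (r * (s * x)))%g).+1.
  by apply: descents_braid; rewrite // eq_sym.
rewrite (IHn (ell (r * x)%g) _ (r * x)%g s) //; last by rewrite -er.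
rewrite (IHn (ell (s * (r * x))%g) _ (s * (r * x))%g r) //; last by lia.
rewrite (IHn (ell (s * x)%g) _ (s * x)%g r) //; last by lia.
rewrite (IHn (ell (r * (s * x))%g) _ (r * (s * x))%g s) //; last by lia.
have sr : s != r by rewrite eq_sym.
have <- : (r * (s * (r * x)) = s * (r * (s * x)))%g.
  by rewrite [LHS]mulgA [LHS]mulgA [RHS]mulgA [RHS]mulgA (simple_braid ss rs sr).
exact: hact_gen_braid.
Qed.

Lemma hact_tau0 j f : hact (tau ^+ j.+1)%g f = Rt (hact (tau ^+ j)%g f).
Proof.
have [t0 t1 t2 t3] := tauXE.
have neq (a b c d : int) g h : g <> h -> (mk a b g == mk c d h) = false.
  by move=> gh; apply/eqP => /mk_inj[].
have E i : hact (tau ^+ i)%g f = hact_tau_power (tau ^+ i)%g f.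
  by rewrite /hact ell_tauX.
have tauX3 i : (tau ^+ (i %% 3))%g = (tau ^+ i)%g.
  by rewrite [in RHS](divn_eq i 3) mulnC expgnDr expgM t3 -mk1 expg1n mul1g.
have F0 : hact_tau_power (tau ^+ 0)%g f = f.
  by rewrite /hact_tau_power t0 t2 tauE !neq.
have F1 : hact_tau_power (tau ^+ 1)%g f = Rt f.
  by rewrite /hact_tau_power expg1 eqxx.
have F2 : hact_tau_power (tau ^+ 2)%g f = RtV f.
  by rewrite /hact_tau_power t2 tauE eqxx neq.
rewrite !E -(tauX3 j) -(tauX3 j.+1) -addn1 -modnDml addn1.
move: (j %% 3)%N (ltn_pmod j (isT : 0 < 3)%N) => [|[|[|//]]] _.
- by rewrite modn_small // F0 F1.
- by rewrite modn_small // F1 F2 Rt2.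
- by rewrite modnn F0 F2 RtVK.
Qed.

Lemma hact_tau (x : ext_aff) f : hact (tau * x)%g f = Rt (hact x f).
Proof.
move: {2}(ell x) (leqnn (ell x)) => n; elim: n x => [|n IHn] x le_n.
  have [|j _ ->] := @ell_eq0 x; first by lia.
  by rewrite -expgS hact_tau0.
have [x0|x_gt0] := posnP (ell x); first by apply: IHn; rewrite x0.
have [s ss e] := ell_descent x_gt0.
rewrite (hact_step f ss e).
have [s' s's [ts Rts]] : exists2 s' : ext_aff, s' \in simple_refl &
    (s' * tau = tau * s)%g /\ forall g, Rt (hact_gen s g) = hact_gen s' (Rt g).
  case/simple_reflP: ss => ->; [exists s1 | exists s2 | exists s0];
    rewrite ?s0_simple ?s1_simple ?s2_simple //; split;
    try (by rewrite !genE !mkM /=; congr mk; ring);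
    by move=> g; case: (hact_gen_tau g).
have s'tx : (s' * (tau * x) = tau * (s * x))%g.
  by rewrite mulgA ts mulgA.
rewrite (hact_step f s's) s'tx ?ell_tau_l // IHn ?Rts //; by lia.
Qed.

Lemma hact_one f : hact 1%g f = f.
Proof.
rewrite /hact ell_one /= /hact_tau_power.
have [t0 t1 t2 _] := tauXE.
by rewrite mk1 t2 tauE; do !case: eqP => [/mk_inj[]//|_].
Qed.

Lemma hact_mul (x y : ext_aff) f : ell (x * y)%g = (ell x + ell y)%N ->
  hact (x * y)%g f = hact x (hact y f).
Proof.
move: {2}(ell x) (leqnn (ell x)) => n; elim: n x => [|n IHn] x le_n.
  have [|j _ ->] := @ell_eq0 x; first by lia.
  elim: j => [|j IHj].
    by move=> _; rewrite expg0 mul1g hact_one.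
  rewrite expgS => e; rewrite -mulgA !hact_tau IHj //.
  have e' : (tau * tau ^+ j * y = tau * (tau ^+ j * y))%g by rewrite mulgA.
  by move: e; rewrite e' !ell_tau_l.
move=> exy; have [x0|x_gt0] := posnP (ell x); first by apply: IHn; rewrite // x0.
have [s ss e] := ell_descent x_gt0.
have sxy : (s * (x * y) = s * x * y)%g by rewrite mulgA.
(* Subadditivity of the length forces [s] to shorten the whole product, so the product stays reduced
   once its first letter is removed. *)
have := ell_mul_le (s * x)%g y; rewrite -sxy => le_sxy.
have e2 : ell (x * y)%g = (ell (s * (x * y))%g).+1.
  by case: (ell_simple_l (x * y)%g ss); lia.
rewrite (hact_step f ss e2) (hact_step _ ss e) sxy IHn ?sxy //; first by lia.
by rewrite -sxy; lia.
Qed.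

Definition state_linear (R : (state -> laurent) -> state -> laurent) : Prop :=
  forall a f g, R (fun x => a * f x + g x) = (fun x => a * R f x + R g x).

(** Shifts act as the monomials in the formal parameters of the labels; commuting with them is
    linearity over the ring of these parameters. *)
Definition shift (nu : nat -> int) (x : state) : state :=
  let sh (p : particle) := (p.1, p.2 + nu p.1) in
  let: (p, q, r) := x in (sh p, sh q, sh r).

Definition shift_invariant (R : (state -> laurent) -> state -> laurent) : Prop :=
  forall nu f, R (f \o shift nu) = R f \o shift nu.

Lemma R1_linear : state_linear R1.
Proof.
move=> a f g; apply/funext => -[[p q] r]; rewrite /R1.
by case: ifP => _; [ring | case: ifP => _; ring].
Qed.

Lemma R1_shift : shift_invariant R1.
Proof.
move=> nu f; apply/funext => -[[[a x] [b y]] [c z]]; rewrite /R1 /= /move_by /=.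
by rewrite (addrAC y) (addrAC x).
Qed.

Lemma hact_ind (P : ((state -> laurent) -> state -> laurent) -> Prop) :
  P id -> P R1 -> P Rt -> (forall R S, P R -> P S -> P (R \o S)) ->
  forall x, P (hact x).
Proof.
move=> Pid P1 Pt PM.
have PtV : P RtV.
  rewrite (_ : RtV = Rt \o Rt); first exact: PM.
  by apply/funext => f; rewrite /= Rt2.
have Pg s : P (hact_gen s).
  rewrite /hact_gen; case: (s == s1) => //; case: (s == s2).
  - by have := PM _ _ Pt (PM _ _ P1 PtV).
  - by have := PM _ _ PtV (PM _ _ P1 Pt).
move=> x; rewrite /hact; move: (ell x) => n; elim: n x => [|n IHn] x /=.
  by rewrite /hact_tau_power; case: (_ == _) => //; case: (_ == _).
exact: PM (Pg _) (IHn _).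
Qed.

Lemma hact_linear x : state_linear (hact x).
Proof.
apply: (hact_ind (P := state_linear)) => //; first exact: R1_linear.
by move=> R S Rl Sl a f g /=; rewrite Sl Rl.
Qed.

Lemma hact_shift x : shift_invariant (hact x).
Proof.
apply: (hact_ind (P := shift_invariant)) => //; first exact: R1_shift.
- by move=> nu f; apply/funext => -[[p q] r].
- by move=> R S Rl Sl nu f /=; rewrite Sl Rl.
Qed.

Definition delta (y x : state) : laurent := (x == y)%:R.

Definition kernel (w : ext_aff) (x y : state) : laurent := hact w (delta y) x.

Definition word (a b c : nat) : state := ((a, 0), (b, 0), (c, 0)).

Lemma shift_inj nu : injective (shift nu).
Proof.
apply: (can_inj (g := shift (fun l => - nu l))) => x.
by case: x => -[[a x] [b y]] [c z]; rewrite /shift /= !addrK.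
Qed.

Lemma kernel_shift w nu x y : kernel w (shift nu x) (shift nu y) = kernel w x y.
Proof.
have E : delta (shift nu y) \o shift nu = delta y.
  by apply/funext => z; rewrite /delta /= (inj_eq (@shift_inj nu)).
by rewrite {2}/kernel -E hact_shift.
Qed.

(** The matrix of [R1] is symmetric: [swap01] is an involution and the diagonal entries depend on
    the labels alone. *)
Lemma R1_delta a b c (x y z : int) : let s := ((a, x), (b, y), (c, z)) in
  R1 (delta s) = if a == b then (fun u => v * delta s u) else
    (fun u => delta (swap01 s) u +
              (if (b < a)%N then (v - vinv) * delta s u else 0)).
Proof.
move=> s; apply/funext => -[[[a' x'] [b' y']] [c' z']].
set u := (_, _, _).
have swapE : delta s (swap01 u) = delta (swap01 s) u.
  by rewrite /delta -(inj_eq (inv_inj swap01K)) swap01K.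
rewrite /R1 -/u swapE /=; have [es|ne] := eqVneq u s.
  by case: es => ea _ eb _ _ _; rewrite ea eb; case: ifP.
have d0 : delta s u = 0 by rewrite /delta (negPf ne).
have [eab|nab] := eqVneq a b; have [eab'|nab'] := eqVneq a' b';
  rewrite /= ?d0 ?mulr0 ?if_same ?addr0 // /delta;
  case: eqP => // -[ea' _ eb' _ _ _].
- by rewrite ea' eb' eab eqxx in nab'.
- by rewrite -ea' -eb' eab' eqxx in nab.
Qed.

Lemma hact_s1 f : hact s1 f = R1 f.
Proof.
have e : ell s1 = (ell (s1 * s1)%g).+1.
  by rewrite simple_reflV ?s1_simple // ell_one ell_simple ?s1_simple.
rewrite (hact_step f s1_simple e) simple_reflV ?s1_simple // hact_one.
by case: (hact_gens f).
Qed.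

(** The shift [nu] carries the two arguments on the right to those on the left. It must not move a
    third particle sharing a label with one of the first two, whence the conditions on [wt]. *)
Lemma kernel_swap w mu a b c : a != b -> (c == a -> wt a = 0) ->
  (c == b -> wt b = 0) ->
  kernel w (swap01 (word a b c)) (shift mu (word a b c)) =
  kernel w (word b a c) (swap01 (shift mu (word b a c))).
Proof.
move=> nab ca cb.
pose nu l := if l == a then wt a else if l == b then - wt b else 0.
rewrite -[RHS](kernel_shift w nu); congr (kernel w _ _).
  rewrite /shift /word /swap01 /move_by /nu /= eqxx eq_sym (negPf nab) eqxx.
  congr (_, _, (_, _)); [congr pair; ring | congr pair; ring |].
  case: eqP => [e|_]; first by rewrite ca ?e ?addr0.
  by case: eqP => [e|_]; rewrite ?cb ?e ?oppr0 ?addr0.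
rewrite /shift /word /swap01 /move_by /nu /= eqxx eq_sym (negPf nab) eqxx.
congr (_, _, (_, _)); [congr pair; ring | congr pair; ring |].
case: eqP => [e|_]; first by rewrite ca ?e ?addr0.
by case: eqP => [e|_]; rewrite ?cb ?e ?oppr0 ?addr0.
Qed.

Definition words_distinct : seq state := [:: word 0 1 2; word 1 0 2; word 0 2 1;
  word 2 0 1; word 1 2 0; word 2 1 0].
Definition words_vector : seq state := [:: word 0 2 2; word 2 0 2; word 2 2 0].

(* The words in B represent the states modulo shifts, so this is a coefficient
   of the trace over the ring of shifts. *)
Definition twisted_trace (B : seq state) (mu : nat -> int)
    (R : (state -> laurent) -> state -> laurent) : laurent :=
  \sum_(u <- B) R (delta (shift mu u)) u.

Lemma R1_word w mu a b c :
  R1 (hact w (delta (shift mu (word a b c)))) (word a b c) =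
  if a == b then v * kernel w (word a b c) (shift mu (word a b c)) else
  kernel w (swap01 (word a b c)) (shift mu (word a b c)) +
  (if (b < a)%N then (v - vinv) * kernel w (word a b c) (shift mu (word a b c))
   else 0).
Proof. by []. Qed.

Lemma hact0 w : hact w (fun=> 0) = (fun=> 0).
Proof.
have := hact_linear w 1 (fun=> 0) (fun=> 0); rewrite (_ : (fun _ => _) = fun=> 0).
  move=> e; apply/funext => x; apply: (addrI (hact w (fun=> 0) x)).
  by rewrite {3}e mul1r addr0.
by apply/funext => x; rewrite mulr0 addr0.
Qed.

Lemma hactZ w a f : hact w (fun x => a * f x) = (fun x => a * hact w f x).
Proof.
have := hact_linear w a f (fun=> 0); rewrite hact0.
rewrite (_ : (fun x => a * f x + 0) = fun x => a * f x).
  by move=> ->; apply/funext => x; rewrite addr0.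
by apply/funext => x; rewrite addr0.
Qed.

Lemma hactD w f g :
  hact w (fun x => f x + g x) = (fun x => hact w f x + hact w g x).
Proof.
have := hact_linear w 1 f g.
rewrite (_ : (fun x => 1 * f x + g x) = fun x => f x + g x).
  by move=> ->; apply/funext => x; rewrite mul1r.
by apply/funext => x; rewrite mul1r.
Qed.

Lemma word_R1 w mu a b c :
  hact w (R1 (delta (shift mu (word a b c)))) (word a b c) =
  if a == b then v * kernel w (word a b c) (shift mu (word a b c)) else
  kernel w (word a b c) (swap01 (shift mu (word a b c))) +
  (if (b < a)%N then (v - vinv) * kernel w (word a b c) (shift mu (word a b c))
   else 0).
Proof.
rewrite /shift /word /= R1_delta; case: eqP => [ab|nab]; first by rewrite hactZ.
by case: ifP => lt; rewrite hactD ?hactZ ?hact0.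
Qed.

Arguments R1 : simpl never.
Arguments Rt : simpl never.
Arguments swap01 : simpl never.
Arguments shift : simpl never.
Arguments word : simpl never.

(** Diagonal terms agree; the off-diagonal term of a word matches that of the word with its first
    two letters exchanged, and this exchange preserves [B]. *)
Lemma twisted_trace_s1 w mu B : B = words_distinct \/ B = words_vector ->
  twisted_trace B mu (R1 \o hact w) = twisted_trace B mu (hact w \o R1).
Proof.
case=> ->; rewrite /twisted_trace !big_cons !big_nil /= !R1_word !word_R1 /=.
- by rewrite !kernel_swap //; ring.
- by rewrite (@kernel_swap w mu 0 2 2) // (@kernel_swap w mu 2 0 2) //; ring.
Qed.

Lemma word_tau w mu a b c :
  hact w (Rt (delta (shift mu (word a b c)))) (word a b c) =
  kernel w (word a b c) (shift mu (word c a b)).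
Proof.
rewrite /kernel; congr (hact w _ _); apply/funext => x.
by rewrite /Rt /delta -(can_eq turnVK) turnK.
Qed.

Lemma tau_word w mu a b c :
  Rt (hact w (delta (shift mu (word a b c)))) (word a b c) =
  kernel w (word b c a) (shift mu (word a b c)).
Proof. by []. Qed.

(** The terms correspond under cyclic rotation of the words, which preserves [B]. *)
Lemma twisted_trace_tau w mu B : B = words_distinct \/ B = words_vector ->
  twisted_trace B mu (Rt \o hact w) = twisted_trace B mu (hact w \o Rt).
Proof.
by case=> ->; rewrite /twisted_trace !big_cons !big_nil /= !tau_word !word_tau;
  ring.
Qed.

Section TraceFunctions.

Variables (H : algType laurent) (T : ext_aff -> H).
Hypothesis hH : is_hecke_algebra T.

Definition trace_function (phi : ext_aff -> laurent) : Prop :=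
  exists F : H -> laurent, [/\ linear_for *%R F, forall x, F (T x) = phi x &
    forall h, commutator_span h -> F h = 0].

(** Multiplication by [T s1] becomes composition with [R1]: directly when the length grows, through
    the quadratic relation when it drops. *)
Lemma twisted_trace_function B mu : B = words_distinct \/ B = words_vector ->
  trace_function (fun w => twisted_trace B mu (hact w)).
Proof.
move=> BE; have [F [Fl FT]] :=
  linear_extension hH (fun w => twisted_trace B mu (hact w)).
exists F; split=> //; apply: (trace_commutator_span hH Fl) => x; last first.
  rewrite (hecke_tau_l hH) (hecke_tau_r hH) !FT.
  transitivity (twisted_trace B mu (Rt \o hact x)).
    by apply: eq_bigr => u _; rewrite hact_tau.
  rewrite twisted_trace_tau //; apply: eq_bigr => u _ /=.
  rewrite hact_mul; last by rewrite ell_tau_r (ell_tauX 1) addn0.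
  by rewrite -[tau in RHS]mulg1 hact_tau hact_one.
transitivity (twisted_trace B mu (R1 \o hact x)).
  have [up|down] := ell_simple_l x s1_simple.
    rewrite (hecke_up_l hH) ?s1_simple // FT; apply: eq_bigr => u _ /=.
    rewrite (@hact_step (s1 * x)%g s1) ?s1_simple //.
      rewrite mulgA simple_reflV ?s1_simple // mul1g.
      by have [_ -> _] := hact_gens (hact x (delta (shift mu u))).
    by rewrite mulgA simple_reflV ?s1_simple // mul1g.
  rewrite (hecke_down_l hH) ?s1_simple // (linear_forD Fl) (linear_forZ Fl) !FT.
  rewrite /twisted_trace mulr_sumr -big_split /=; apply: eq_bigr => u _.
  rewrite (hact_step _ s1_simple down).
  set f := hact _ _; have [_ -> _] := hact_gens f.
  by rewrite R1_sqr.
rewrite twisted_trace_s1 //.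
have [up|down] := ell_simple_r x s1_simple.
  rewrite (hecke_up_r hH) ?s1_simple // FT; apply: eq_bigr => u _ /=.
  have e : ell (x * s1)%g = (ell x + ell s1)%N.
    by rewrite up (ell_simple s1_simple) addn1.
  by rewrite (hact_mul _ e) hact_s1.
rewrite (hecke_down_r hH) ?s1_simple // (linear_forD Fl) (linear_forZ Fl) !FT.
rewrite /twisted_trace mulr_sumr -big_split /=; apply: eq_bigr => u _.
have xE f : hact x f = hact (x * s1)%g (R1 f).
  have xss : (x * s1 * s1 = x)%g by rewrite -mulgA simple_reflV ?s1_simple ?mulg1.
  rewrite -hact_s1 -hact_mul xss // down (ell_simple s1_simple).
  by rewrite addn1.
rewrite /= !xE; set f := delta _.
rewrite (_ : R1 (R1 f) = fun y => f y + (v - vinv) * R1 f y); last first.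
  by apply/funext => y; rewrite R1_sqr.
by rewrite hactD hactZ.
Qed.

(** The class of the translation part in P/Q, on which W acts trivially; it tells the three cosets
    of W_a apart. *)
Definition component (x : ext_aff) : int :=
  (((transl x).1 - (transl x).2) %% 3)%Z.

(** The algebra is graded by [component], so the character sending each [T s] to [v] remains a trace
    when restricted to one degree. This replaces twisting by cube roots of unity. *)
Lemma component_trace_function (j : int) :
  trace_function (fun x => (component x == j)%:R * v ^+ ell x).
Proof.
have [F [Fl FT]] := linear_extension hH
  (fun x => (component x == j)%:R * v ^+ ell x).
exists F; split=> //; apply: (trace_commutator_span hH Fl) => x; last first.
  rewrite (hecke_tau_l hH) (hecke_tau_r hH) !FT ell_tau_l ell_tau_r.
  congr ((_ == _)%:R * _); have [a [b [g ->]]] := mkP x.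
  by rewrite tauE !mkM /component; case: g => /=; lia.
have [c1 c2] : component (s1 * x)%g = component x /\
    component (x * s1)%g = component x.
  have [a [b [g ->]]] := mkP x.
  by rewrite s1E !mkM /component; case: g => /=; lia.
have vv : v * v = 1 + (v - vinv) * v := v_sqr.
transitivity ((component x == j)%:R * v ^+ (ell x).+1).
  have [up|down] := ell_simple_l x s1_simple.
    by rewrite (hecke_up_l hH) ?s1_simple // FT c1 up.
  rewrite (hecke_down_l hH) ?s1_simple // (linear_forD Fl) (linear_forZ Fl).
  rewrite !FT c1.
  rewrite down; move: (ell (s1 * x)%g) => n.
  by rewrite !exprS [v * (v * _)]mulrA vv; ring.
have [up|down] := ell_simple_r x s1_simple.
  by rewrite (hecke_up_r hH) ?s1_simple // FT c2 up.
rewrite (hecke_down_r hH) ?s1_simple // (linear_forD Fl) (linear_forZ Fl) !FT c2.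
rewrite down; move: (ell (x * s1)%g) => n.
by rewrite !exprS [v * (v * _)]mulrA vv; ring.
Qed.

End TraceFunctions.

(** * Specialisation at v = 1 *)

Lemma tofrac_inj (p q : {poly int}) : tofrac p = tofrac q -> p = q.
Proof.
by move/eqP; rewrite tofrac_eq => /eqP.
Qed.

Lemma laurentE (x : laurent) : exists pn : {poly int} * nat,
  val x * tofrac 'X^(pn.2) = tofrac pn.1.
Proof. by have /asboolP[p [n e]] := laurentP x; exists (p, n). Qed.

Lemma tofracXn_neq0 n : tofrac ('X^n : {poly int}) != 0.
Proof. by rewrite tofrac_eq0 -size_poly_eq0 size_polyXn. Qed.

Lemma laurent_valD (x y : laurent) : val (x + y) = val x + val y.
Proof. exact: rmorphD. Qed.

Lemma laurent_valM (x y : laurent) : val (x * y) = val x * val y.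
Proof. exact: rmorphM. Qed.

Lemma laurent_mulI (a x y : laurent) : a != 0 -> a * x = a * y -> x = y.
Proof.
move=> a0 /(congr1 val); rewrite !rmorphM => e.
have: val a * (val x - val y) = 0.
  by rewrite mulrBr; apply/eqP; rewrite subr_eq0 e.
move/eqP; rewrite mulf_eq0 subr_eq0 => /orP[/eqP a0'|/eqP/val_inj//].
by case/eqP: a0; apply: val_inj.
Qed.

(** The value is the numerator at 1, independent of the power of [v] in the denominator; the factor
    theorem gives the kernel. *)
Lemma laurent_eval1 : exists e : laurent -> int,
  [/\ {morph e : x y / x + y}, {morph e : x y / x * y}, e 1 = 1,
      e v = 1 /\ e vinv = 1 & forall x, e x = 0 -> exists y, x = (v - 1) * y].
Proof.
have [f fE] := choice laurentE.
pose e x := (f x).1.[1].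
have eE (x : laurent) (p : {poly int}) n :
    val x * tofrac 'X^n = tofrac p -> e x = p.[1].
  move=> xE; have /(congr1 (horner^~ 1)) : p * 'X^((f x).2) = (f x).1 * 'X^n.
    by apply: tofrac_inj; rewrite !rmorphM /= -xE -fE mulrAC.
  by rewrite !hornerM !hornerXn !expr1n !mulr1.
exists e; split.
- move=> x y; rewrite (eE _ ((f x).1 * 'X^((f y).2) + (f y).1 * 'X^((f x).2))
    ((f x).2 + (f y).2)%N).
    by rewrite hornerD !hornerM !hornerXn !expr1n !mulr1.
  by rewrite exprD laurent_valD tofracD !tofracM -!fE; ring.
- move=> x y; rewrite (eE _ ((f x).1 * (f y).1) ((f x).2 + (f y).2)%N).
    by rewrite hornerM.
  by rewrite exprD laurent_valM !tofracM -!fE; ring.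
- by rewrite (eE _ 1 0) ?hornerC // expr0 !rmorph1 mulr1.
- split; first by rewrite (eE _ 'X 0) ?hornerX // expr0 rmorph1 mulr1.
  rewrite (eE _ 1 1%N) ?hornerC // expr1 rmorph1 /= mulVf //.
  by rewrite tofrac_eq0 polyX_eq0.
- move=> x ex; have /factor_theorem[q qE] : root (f x).1 1 by apply/eqP.
  have yP : tofrac q / tofrac 'X^((f x).2) \in is_laurent.
    by apply/asboolP; exists q, (f x).2; rewrite divfK ?tofracXn_neq0.
  exists (Laurent yP); apply: val_inj.
  rewrite rmorphM rmorphB rmorph1 /=.
  apply: (mulIf (tofracXn_neq0 (f x).2)).
  rewrite fE qE rmorphM rmorphB /= rmorph1 -!mulrA mulVf ?tofracXn_neq0 //.
  by rewrite mulr1 mulrC.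
Qed.

Lemma v_neq1 : v - 1 != 0.
Proof.
apply/eqP => /(congr1 val); rewrite rmorphB rmorph1 rmorph0 /= => /eqP.
rewrite -tofrac1 -tofracB tofrac_eq0 -size_poly_eq0.
by rewrite -['X - 1]/('X - 1%:P) size_XsubC.
Qed.

(** The multiplicity of the root 1 in a nonzero numerator bounds the powers of [v - 1] dividing
    it. *)
Lemma laurent_v1_adic (x : laurent) :
  (forall n, exists y, x = (v - 1) ^+ n * y) -> x = 0.
Proof.
move=> xn; apply: contrapT => /eqP x0; have [[p m] /= xE] := laurentE x.
have p0 : p != 0.
  apply: contraNneq x0 => p0; apply/eqP/val_inj; apply: (mulIf (tofracXn_neq0 m)).
  by rewrite xE p0 rmorph0 mul0r.
have [k [q]] := multiplicity_XsubC p 1; rewrite p0 /= => q1 pE.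
have [y yE] := xn k.+1; have [[r l] /= rE] := laurentE y.
have : q * 'X^l = ('X - 1%:P) * r * 'X^m.
  apply: (@mulfI _ (('X - 1%:P) ^+ k)); first by rewrite expf_neq0 ?polyXsubC_eq0.
  apply: tofrac_inj; rewrite mulrA [_ * q]mulrC -pE !tofracM -xE -rE yE.
  have valX i : val ((v - 1) ^+ i) = tofrac (('X - 1%:P) ^+ i).
    by rewrite rmorphXn rmorphB rmorph1 /= tofracXn tofracB tofrac1.
  by rewrite laurent_valM valX exprS !tofracM -[laurent_val y]/(val y); ring.
move/(congr1 (horner^~ 1)); rewrite !hornerM !hornerXn !expr1n !mulr1.
by rewrite hornerXsubC subrr mul0r => /eqP q0; case/negP: q1.
Qed.

(** * Conjugacy of translations, reflections and rotations *)

Definition conj_to (x y : ext_aff) : Prop := exists g, y = (x ^ g)%g.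

Lemma conj_to_refl x : conj_to x x.
Proof. by exists 1%g; rewrite conjg1. Qed.

Lemma conj_to_sym x y : conj_to x y -> conj_to y x.
Proof. by case=> g ->; exists (g^-1)%g; rewrite conjgK. Qed.

Lemma conj_to_trans x y z : conj_to x y -> conj_to y z -> conj_to x z.
Proof. by case=> g -> [h ->]; exists (g * h)%g; rewrite conjgM. Qed.

Lemma conj_toM (g x : ext_aff) : conj_to x (g * x * g^-1)%g.
Proof. by exists (g^-1)%g; rewrite conjgE invgK mulgA. Qed.

Lemma conj_to_transl a b h : conj_to (mk a b W1)
  (mk (weyl_act h (a, b)).1 (weyl_act h (a, b)).2 W1).
Proof.
have -> : mk (weyl_act h (a, b)).1 (weyl_act h (a, b)).2 W1 =
    (mk 0 0 h * mk a b W1 * (mk 0 0 h)^-1)%g; last exact: conj_toM.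
by rewrite mkV !mkM; case: h => /=; congr mk; ring.
Qed.

Definition is_reflection (g : weyl) : bool :=
  match g with Ws1 | Ws2 | Ws121 => true | _ => false end.

(* Three times the coordinate, in the traceless realisation of the coweight
   space, that is fixed by the reflection. *)
Definition reflection_inv (a b : int) (g : weyl) : int :=
  match g with
  | Ws1 => a + 2 * b | Ws2 => - (2 * a + b) | Ws121 => a - b | _ => 0
  end.

Lemma conj_to_reflection_s1 a b g : is_reflection g ->
  conj_to (mk a b g) (mk (reflection_inv a b g) 0 Ws1).
Proof.
have to_s1 c d : conj_to (mk c d Ws1) (mk (c + 2 * d) 0 Ws1).
  have -> : mk (c + 2 * d) 0 Ws1 = (mk d 0 W1 * mk c d Ws1 * (mk d 0 W1)^-1)%g.
    by rewrite mkV !mkM /=; congr mk; ring.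
  exact: conj_toM.
have via c d : conj_to (mk a b g) (mk c d Ws1) ->
    reflection_inv a b g = c + 2 * d ->
    conj_to (mk a b g) (mk (reflection_inv a b g) 0 Ws1).
  by move=> h1 ->; apply: conj_to_trans h1 (to_s1 _ _).
have conj h : conj_to (mk a b g) (mk 0 0 h * mk a b g * (mk 0 0 h)^-1)%g.
  exact: conj_toM.
case: g via conj => // via conj _.
- apply: (via b (- a - b)) => /=; last by ring.
  have := conj Ws21; rewrite mkV !mkM /=; congr (conj_to _ _).
  by congr mk; ring.
- apply: (via (a + b) (- b)) => /=; last by ring.
  have := conj Ws2; rewrite mkV !mkM /=; congr (conj_to _ _).
  by congr mk; ring.
Qed.

Lemma conj_to_reflection a b g c d h : is_reflection g -> is_reflection h ->
  reflection_inv a b g = reflection_inv c d h -> conj_to (mk a b g) (mk c d h).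
Proof.
move=> rg rh e; apply: conj_to_trans (conj_to_reflection_s1 a b rg) _.
by rewrite e; apply: conj_to_sym; apply: conj_to_reflection_s1.
Qed.

Definition is_rotation (g : weyl) : bool :=
  match g with Ws12 | Ws21 => true | _ => false end.

Lemma component_mk a b g : component (mk a b g) = ((a - b) %% 3)%Z.
Proof. by []. Qed.

(** Conjugating by t^mu changes the translation part of a rotation w by mu - w mu, and these
    differences fill Q. Conjugation by [s1] exchanges the two rotations. *)
Lemma conj_to_rotation a b g c d h : is_rotation g -> is_rotation h ->
  component (mk a b g) = component (mk c d h) -> conj_to (mk a b g) (mk c d h).
Proof.
rewrite !component_mk.
have s12 a' b' c' d' : ((a' - b') %% 3 = (c' - d') %% 3)%Z ->
    conj_to (mk a' b' Ws12) (mk c' d' Ws12).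
  (* [k] solves [2 * k + (k + (d' - b')) = c' - a']; the congruence makes the division exact. *)
  move=> e; pose k := (((c' - a') - (d' - b')) %/ 3)%Z.
  have -> : mk c' d' Ws12 =
      (mk k (k + (d' - b')) W1 * mk a' b' Ws12 * (mk k (k + (d' - b')) W1)^-1)%g.
    by rewrite mkV !mkM /=; congr mk; rewrite /k; lia.
  exact: conj_toM.
have s21 a' b' : conj_to (mk a' b' Ws21) (mk (- a') (a' + b') Ws12).
  have -> : mk (- a') (a' + b') Ws12 =
      (mk 0 0 Ws1 * mk a' b' Ws21 * (mk 0 0 Ws1)^-1)%g.
    by rewrite mkV !mkM /=; congr mk; ring.
  exact: conj_toM.
case: g => //; case: h => // _ _ e.
- exact: s12.
- by apply: conj_to_trans (conj_to_sym (s21 _ _)); apply: s12; lia.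
- by apply: conj_to_trans (s21 _ _) _; apply: s12; lia.
- apply: conj_to_trans (s21 _ _) (conj_to_trans _ (conj_to_sym (s21 _ _))).
  by apply: s12; lia.
Qed.

(* The affine permutation [mk a b g] moves the particle in position i to
   position g(i), its exponent changing by the (traceless) displacement. *)
Definition displace (a b : int) (g : weyl) (x : state) : state :=
  let: (p, q, r) := x in
  let d0 := - (2 * a + b) in let d1 := a - b in let d2 := a + 2 * b in
  match g with
  | W1 => (move_by d0 p, move_by d1 q, move_by d2 r)
  | Ws1 => (move_by (d1 - 1) q, move_by (d0 + 1) p, move_by d2 r)
  | Ws2 => (move_by d0 p, move_by (d2 - 1) r, move_by (d1 + 1) q)
  | Ws12 => (move_by (d1 - 1) q, move_by (d2 - 1) r, move_by (d0 + 2) p)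
  | Ws21 => (move_by (d2 - 2) r, move_by (d0 + 1) p, move_by (d1 + 1) q)
  | Ws121 => (move_by (d2 - 2) r, move_by d1 q, move_by (d0 + 2) p)
  end.

(* Under this condition swap01 fixes the states whose first two labels agree. *)
Definition good_state (x : state) : Prop :=
  let: (p, q, r) := x in
  [/\ p.1 = q.1 -> p = q /\ wt p.1 = 0, q.1 = r.1 -> q = r /\ wt q.1 = 0
    & r.1 = p.1 -> r = p /\ wt r.1 = 0].

Lemma good_turn x : good_state x -> good_state (turn x).
Proof. by case: x => -[p q] r []. Qed.

Lemma good_turnV x : good_state x -> good_state (turnV x).
Proof. by case: x => -[p q] r []. Qed.

Lemma move_by_wt0 d p : wt p.1 = 0 -> move_by d p = p.
Proof. by case: p => l x /= w0; rewrite /move_by /= w0 mul0r addr0. Qed.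

Lemma good_swap01 x : good_state x -> good_state (swap01 x).
Proof.
case: x => -[p q] r [pq qr rp]; split=> /=.
- by move=> e; have [pq' w0] := pq (esym e); rewrite -pq' !move_by_wt0.
- by move=> e; have [rp' w0] := rp (esym e); rewrite -rp' move_by_wt0.
- move=> e; have [qr' w0] := qr (esym e); rewrite -qr' in w0 *.
  by rewrite move_by_wt0.
Qed.

Section Specialisation.

Variable e : laurent -> int.
Hypothesis eD : {morph e : x y / x + y}.
Hypothesis eM : {morph e : x y / x * y}.
Hypothesis e1 : e 1 = 1.
Hypothesis ev : e v = 1.
Hypothesis evinv : e vinv = 1.

Lemma eval_0 : e 0 = 0.
Proof. by apply: (addrI (e 0)); rewrite -eD !addr0. Qed.

Lemma eval_sum (I : Type) (r : seq I) (F : I -> laurent) :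
  e (\sum_(i <- r) F i) = \sum_(i <- r) e (F i).
Proof. exact: (big_morph e eD eval_0). Qed.

Lemma eval_sub_v_vinv : e (v - vinv) = 0.
Proof. by apply: (addIr (e vinv)); rewrite -eD subrK ev evinv add0r. Qed.

(** The term in [v - vinv] dies at [v = 1]. On a good state equal labels mean equal untracked
    particles, so the branch with the scalar [v] is also the swap. *)
Lemma eval_R1 f x : good_state x -> e (R1 f x) = e (f (swap01 x)).
Proof.
case: x => -[p q] r [pq _ _]; rewrite /R1; case: eqP => [/pq[<- w0]|_].
  by rewrite eM ev mul1r /swap01 !move_by_wt0.
by rewrite eD; case: ifP => _; rewrite ?eM ?eval_sub_v_vinv ?mul0r ?eval_0 addr0.
Qed.

Definition swap_gen (s : ext_aff) (x : state) : state :=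
  if s == s1 then swap01 x else
  if s == s2 then turnV (swap01 (turn x)) else turn (swap01 (turnV x)).

Lemma eval_hact_gen s f x :
  good_state x -> e (hact_gen s f x) = e (f (swap_gen s x)).
Proof.
move=> gx; rewrite /hact_gen /swap_gen; case: (s == s1); first exact: eval_R1.
case: (s == s2); rewrite /R2 /R0.
- exact: (eval_R1 (RtV f) (good_turn gx)).
- exact: (eval_R1 (Rt f) (good_turnV gx)).
Qed.

Lemma good_swap_gen s x : good_state x -> good_state (swap_gen s x).
Proof.
move=> gx; rewrite /swap_gen; case: (s == s1); first exact: good_swap01.
case: (s == s2).
- by apply: good_turnV; apply: good_swap01; apply: good_turn.
- by apply: good_turn; apply: good_swap01; apply: good_turnV.
Qed.

Lemma displace_gen s a b g : s \in simple_refl -> exists c d h,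
  (s * mk a b g)%g = mk c d h /\
  forall x, displace c d h (swap_gen s x) = displace a b g x.
Proof.
have n10 : s0 != s1 by apply/eqP; rewrite s0E s1E => /mk_inj[].
have n20 : s0 != s2 by apply/eqP; rewrite s0E s2E => /mk_inj[].
have n12 : s2 != s1 by apply/eqP; rewrite s2E s1E => /mk_inj[].
rewrite /swap_gen; case/simple_reflP=> ->; rewrite ?eqxx ?(negPf n10) ?(negPf n20)
  ?(negPf n12).
- rewrite s0E mkM; do 3 eexists; split; first reflexivity.
  case=> -[p q] r; rewrite /swap01 /=.
  by case: g => /=; rewrite !move_byD; congr (_, _, _); congr move_by; ring.
- rewrite s1E mkM; do 3 eexists; split; first reflexivity.
  case=> -[p q] r; rewrite /swap01 /=.
  by case: g => /=; rewrite !move_byD; congr (_, _, _); congr move_by; ring.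
- rewrite s2E mkM; do 3 eexists; split; first reflexivity.
  case=> -[p q] r; rewrite /swap01 /=.
  by case: g => /=; rewrite !move_byD; congr (_, _, _); congr move_by; ring.
Qed.

Lemma eval_hact a b g f x : good_state x ->
  e (hact (mk a b g) f x) = e (f (displace a b g x)).
Proof.
move: {2}(ell _) (leqnn (ell (mk a b g))) => n.
elim: n a b g x => [|n IHn] a b g x le_n gx; last first.
  have [x0|x_gt0] := posnP (ell (mk a b g)); first by apply: IHn; rewrite ?x0.
  have [s ss es] := ell_descent x_gt0.
  have [c [d [h [sx dE]]]] := displace_gen a b g ss.
  rewrite (hact_step f ss es) eval_hact_gen // sx IHn ?dE //.
    by move: le_n; rewrite es sx.
  exact: good_swap_gen.
have [|j lt3 xE] := @ell_eq0 (mk a b g); first by lia.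
have hE := hact_tau0 _ f.
move: xE; have [t0 t1 t2 _] := tauXE.
case: j lt3 => [|[|[|//]]] _; rewrite ?t0 ?t1 ?t2 => /mk_inj[-> -> ->].
- rewrite -mk1 hact_one; case: x gx => -[p q] r _; congr (e (f _)).
  by rewrite /= !move_by0.
- rewrite -t1 hE expg0 hact_one; case: x gx => -[p q] r _; congr (e (f _)).
  by rewrite /= !move_by0.
- rewrite -t2 hE hE expg0 hact_one; case: x gx => -[p q] r _; congr (e (f _)).
  by rewrite /= !move_by0.
Qed.

Lemma eval_twisted_trace B mu a b g : {in B, forall u, good_state u} ->
  e (twisted_trace B mu (hact (mk a b g))) =
  \sum_(u <- B) (displace a b g u == shift mu u)%:R.
Proof.
move=> gB; rewrite /twisted_trace eval_sum big_seq [RHS]big_seq.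
apply: eq_bigr => u /gB gu; rewrite eval_hact // /delta.
by case: eqP; rewrite ?e1 ?eval_0.
Qed.

End Specialisation.

(** * Linear independence in the cocenter *)

Lemma sum_nat_of_bool_neq0 (I : Type) (P : pred I) (B : seq I) :
  (\sum_(u <- B) (P u)%:R != 0 :> int) = has P B.
Proof.
have -> : \sum_(u <- B) (P u)%:R = (count P B)%:R :> int.
  by elim: B => [|u B IHB]; rewrite ?big_nil // big_cons IHB /= natrD.
by rewrite pnatr_eq0 -lt0n has_count.
Qed.

(** The order of elimination: a form detecting one kind may also be nonzero on lower kinds. *)
Definition weyl_kind (g : weyl) : nat :=
  if is_rotation g then 2%N else is_reflection g.

Lemma weyl_kindP g : g = W1 \/ is_reflection g \/ is_rotation g.
Proof.
by case: g; [left | right; left | right; left | right; right | right; right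
  | right; left].
Qed.

Lemma words_distinct_good : {in words_distinct, forall u, good_state u}.
Proof.
move=> u; rewrite !inE.
by do 5 (case/orP=> [/eqP->|]; first by split); move/eqP->; split.
Qed.

Lemma words_vector_good : {in words_vector, forall u, good_state u}.
Proof.
move=> u; rewrite !inE.
by do 2 (case/orP=> [/eqP->|]; first by split); move/eqP->; split.
Qed.

Section Independence.

Variables (H : algType laurent) (T : ext_aff -> H).
Hypothesis hH : is_hecke_algebra T.

Variable e : laurent -> int.
Hypothesis eD : {morph e : x y / x + y}.
Hypothesis eM : {morph e : x y / x * y}.
Hypothesis e1 : e 1 = 1.
Hypothesis ev : e v = 1.
Hypothesis evinv : e vinv = 1.
Hypothesis e_ker : forall x, e x = 0 -> exists y, x = (v - 1) * y.

(* Three distinguishable particles see the translations only, one particle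
   among two others sees the fixed points of reflections (and the
   translations), and the one-dimensional module sees everything. *)
Lemma trace_separation a b g : exists2 phi, trace_function T phi &
  e (phi (mk a b g)) != 0 /\ forall c d h, e (phi (mk c d h)) != 0 ->
    conj_to (mk a b g) (mk c d h) \/ (weyl_kind h < weyl_kind g)%N.
Proof.
have eT B mu c d h : {in B, forall u, good_state u} ->
    (e (twisted_trace B mu (hact (mk c d h))) != 0) =
    has (fun u => displace c d h u == shift mu u) B.
  move=> gB; rewrite (eval_twisted_trace eD eM e1 ev evinv) //.
  exact: sum_nat_of_bool_neq0.
have [->|[refl_g|rot_g]] := weyl_kindP g.
  (* Label 2 can stay untracked because the three displacements sum to zero. *)
  pose mu l : int :=
    if l == 0%N then - (2 * a + b) else if l == 1%N then a - b else 0.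
  exists (fun w => twisted_trace words_distinct mu (hact w)).
    by apply: twisted_trace_function => //; left.
  split=> [|c d h]; rewrite (eT _ _ _ _ _ words_distinct_good).
    apply/hasP; exists (word 0 1 2); first by rewrite mem_head.
    by apply/eqP; rewrite /displace /shift /word /move_by /wt /mu /=;
      congr (_, _, _); congr pair; ring.
  (* Distinct labels return to their positions only if [h] is trivial; each of the six words then
     places [(c, d)] in the Weyl orbit of [(a, b)]. *)
  move=> /hasP[u uB /eqP E]; left.
  have Cl k : c = (weyl_act k (a, b)).1 -> d = (weyl_act k (a, b)).2 ->
      conj_to (mk a b W1) (mk c d W1) by move=> -> ->; apply: conj_to_transl.
  clear eT; move: uB E; rewrite !inE.
  have orbit : (exists k, c = (weyl_act k (a, b)).1 /\
      d = (weyl_act k (a, b)).2) -> conj_to (mk a b W1) (mk c d W1).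
    by case=> k [] /Cl.
  do 5 (case/orP=> [/eqP->|]; first by case: h => // -[]; rewrite /wt /mu /= => *;
    apply: orbit; first [ by exists W1 => /=; lia | by exists Ws1 => /=; lia
    | by exists Ws2 => /=; lia | by exists Ws12 => /=; lia
    | by exists Ws21 => /=; lia | by exists Ws121 => /=; lia ]).
  move/eqP=> ->; case: h => // -[]; rewrite /wt /mu /= => *.
  by apply: orbit; exists Ws121 => /=; lia.
- pose mu l : int := if l == 0%N then reflection_inv a b g else 0.
  exists (fun w => twisted_trace words_vector mu (hact w)).
    by apply: twisted_trace_function => //; right.
  split=> [|c d h]; rewrite (eT _ _ _ _ _ words_vector_good); clear eT.
    (* The tracked particle is put at the position fixed by the reflection. *)
    apply/hasP; case: g refl_g @mu => // _ mu;
      [exists (word 2 2 0) | exists (word 0 2 2) | exists (word 2 0 2)];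
      rewrite ?inE ?eqxx ?orbT //; apply/eqP;
      rewrite /displace /shift /word /move_by /wt /mu /=;
      by congr (_, _, _); congr pair; ring.
  move=> /hasP[u uB /eqP E]; have kg : weyl_kind g = 1%N by case: g refl_g {mu E}.
  rewrite kg; have [-> //|[refl_h|rot_h]] := weyl_kindP h; first by right.
    left; apply: conj_to_reflection => //.
    move: uB E; rewrite !inE.
    case/or3P=> /eqP->; case: h refl_h => // _ -[];
      by rewrite /wt /mu /=; lia.
  move: uB E; rewrite !inE.
  by case/or3P=> /eqP->; case: h rot_h.
- exists (fun x => (component x == component (mk a b g))%:R * v ^+ ell x).
    exact: component_trace_function.
  have eX n : e (v ^+ n) = 1.
    by elim: n => [|n IHn]; rewrite ?expr0 // exprS eM ev IHn mulr1.
  rewrite eqxx mul1r eX; split=> // c d h; rewrite eM eX mulr1.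
  have kg : weyl_kind g = 2%N by case: g rot_g.
  have kh : is_reflection h -> (weyl_kind h < 2)%N by clear; case: h.
  rewrite kg; have [->|[/kh|rot_h]] := weyl_kindP h; try by right.
  have [comp _|_] := eqVneq (component (mk c d h)) (component (mk a b g)).
    by left; apply: conj_to_rotation.
  by rewrite (eval_0 eD) eqxx.
Qed.

Lemma cocenter_independence (I : eqType) (s : seq I) (r : I -> ext_aff)
    (d : I -> laurent) : uniq s ->
  {in s &, forall i j, conj_to (r i) (r j) -> i = j} ->
  commutator_span (\sum_(i <- s) d i *: T (r i)) -> {in s, forall i, d i = 0}.
Proof.
move=> us r_inj sum0.
pose Rel (d : I -> laurent) :=
  forall phi, trace_function T phi -> \sum_(i <- s) d i * phi (r i) = 0.
have vanish d' : Rel d' -> {in s, forall i, e (d' i) = 0}.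
  move=> Rd; suff vanish_kind n i a b g : i \in s -> r i = mk a b g ->
      weyl_kind g = n -> e (d' i) = 0.
    by move=> i si; have [a [b [g rE]]] := mkP (r i); apply: vanish_kind rE _.
  (* Where the form is nonzero at 1, another index is either conjugate to [i], which [r_inj]
     excludes, or of lower kind, where the coefficient already vanishes. *)
  elim/ltn_ind: n i a b g => n IHn i a b g si rE kg.
  have [phi phi_tr [phi_i phi_j]] := trace_separation a b g.
  have := congr1 e (Rd phi phi_tr); rewrite (eval_sum eD) (eval_0 eD).
  rewrite (bigD1_seq i) //= big1_seq ?addr0 => [|j /andP[ji sj]].
    by rewrite eM rE => /eqP; rewrite mulf_eq0 (negPf phi_i) orbF => /eqP.
  rewrite eM; apply/eqP; rewrite mulf_eq0 -implyNb; apply/implyP => dj.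
  apply: contraT => phi_rj; have [c [f [h rjE]]] := mkP (r j).
  rewrite rjE in phi_rj; case: (phi_j _ _ _ phi_rj) => [ij|lt].
    by rewrite (r_inj i j) ?rE ?rjE ?eqxx in ji.
  by rewrite (IHn (weyl_kind h) _ j c f h) ?eqxx -?kg in dj.
have Rd : Rel d.
  move=> phi [F [Fl FT F0]]; rewrite -[RHS](F0 _ sum0) (linear_for_sum Fl).
  by apply: eq_bigr => i _; rewrite (linear_forZ Fl) FT.
have divide n : exists2 d', Rel d' & {in s, forall i, d i = (v - 1) ^+ n * d' i}.
  elim: n => [|n [d' Rd' dE]]; first by exists d => // i _; rewrite mul1r.
  have /choice[d2 d2E] i : exists y, i \in s -> d' i = (v - 1) * y.
    have [si|_] := boolP (i \in s); last by exists 0.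
    by have [y ->] := e_ker (vanish _ Rd' i si); exists y.
  exists d2 => [phi phi_tr|i si]; last by rewrite dE // d2E // exprSr mulrA.
  apply: (laurent_mulI v_neq1); rewrite mulr0 mulr_sumr -[RHS](Rd' phi phi_tr).
  by rewrite big_seq [RHS]big_seq; apply: eq_bigr => i si; rewrite mulrA -d2E.
move=> i si; apply: laurent_v1_adic => n.
by have [d' _ dE] := divide n; exists (d' i); rewrite dE.
Qed.

End Independence.

Lemma hecke_cocenter_independence (H : algType laurent) (T : ext_aff -> H)
    (I : eqType) (s : seq I) (r : I -> ext_aff) (d : I -> laurent) :
  is_hecke_algebra T -> uniq s ->
  {in s &, forall i j, conj_to (r i) (r j) -> i = j} ->
  commutator_span (\sum_(i <- s) d i *: T (r i)) -> {in s, forall i, d i = 0}.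
Proof.
have [e [eD eM e1 [ev evinv] e_ker]] := laurent_eval1.
by move=> hH; apply: (cocenter_independence hH eD eM e1 ev evinv e_ker).
Qed.

(** * Reduction to elements of minimal length *)

Section Reduction.

Variables (H : algType laurent) (T : ext_aff -> H).
Hypothesis hH : is_hecke_algebra T.

Local Notation ep := (v - vinv).
Local Notation "x == y %[cocenter]" := (cocenter_eq x y)
  (at level 70, y at next level).

Lemma reduce_same s a b g c d h : s \in simple_refl ->
  (s * mk a b g * s)%g = mk c d h -> mklen c d h = mklen a b g ->
  T (mk a b g) == T (mk c d h) %[cocenter].
Proof.
move=> ss sxs len; apply: cocenter_eq_sym; rewrite -sxs.
by apply: (cocenter_eq_same_length hH ss); rewrite sxs !ellE.
Qed.

Lemma reduce_drop s a b g c d h c' d' h' : s \in simple_refl ->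
  (s * mk a b g * s)%g = mk c d h -> (s * mk a b g)%g = mk c' d' h' ->
  mklen a b g = (mklen c d h).+2 ->
  T (mk a b g) == T (mk c d h) + ep *: T (mk c' d' h') %[cocenter].
Proof.
move=> ss sxs sx len; rewrite -sxs -sx.
by apply: (cocenter_eq_shorter hH ss); rewrite sxs !ellE.
Qed.

Lemma reduce_tau a b g c d h : (tau * mk a b g * tau^-1)%g = mk c d h ->
  T (mk a b g) == T (mk c d h) %[cocenter].
Proof. by move=> <-; apply: cocenter_eq_sym; apply: (cocenter_eq_tau hH). Qed.

(** [s1] and [s2] only permute, up to sign, the three terms of the length of a translation, so no
    correction term appears along a Weyl orbit. *)
Lemma reduce_transl a b h :
  T (mk a b W1) == T (mk (weyl_act h (a, b)).1 (weyl_act h (a, b)).2 W1)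
  %[cocenter].
Proof.
have r1 c d : T (mk c d W1) == T (mk (- c) (c + d) W1) %[cocenter].
  apply: (reduce_same s1_simple); last by rewrite /=; lia.
  by rewrite s1E !mkM /=; congr mk; ring.
have r2 c d : T (mk c d W1) == T (mk (c + d) (- d) W1) %[cocenter].
  apply: (reduce_same s2_simple); last by rewrite /=; lia.
  by rewrite s2E !mkM /=; congr mk; ring.
have tr c d c' d' k l m n : T (mk c d W1) == T (mk c' d' W1) %[cocenter] ->
    T (mk c' d' W1) == T (mk k l W1) %[cocenter] -> k = m -> l = n ->
    T (mk c d W1) == T (mk m n W1) %[cocenter].
  by move=> e1 e2 <- <-; apply: cocenter_eq_trans e2.
case: h => /=.
- exact: cocenter_eq_refl.
- exact: r1.
- exact: r2.
- by apply: tr (r2 _ _) (r1 _ _) _ _; ring.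
- by apply: tr (r1 _ _) (r2 _ _) _ _; ring.
- have r12 := tr _ _ _ _ _ _ _ _ (r1 a b) (r2 _ _) erefl erefl.
  by apply: tr r12 (r1 _ _) _ _; ring.
Qed.

(** Conjugation by [tau] permutes the three linear parts of reflections, so all reflections can be
    brought to [Ws1]. *)
Lemma reduce_Ws121 a b :
  T (mk a b Ws121) == T (mk (2 - a - b) (a - 1) Ws1) %[cocenter].
Proof. by apply: reduce_tau; rewrite tauE mkV !mkM /=; congr mk; ring. Qed.

Lemma reduce_Ws2 a b : T (mk a b Ws2) == T (mk b (- a - b) Ws1) %[cocenter].
Proof.
have e : T (mk a b Ws2) == T (mk (1 - a - b) (a + 1) Ws121) %[cocenter].
  by apply: reduce_tau; rewrite tauE mkV !mkM /=; congr mk; ring.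
apply: cocenter_eq_trans e _.
by have := reduce_Ws121 (1 - a - b) (a + 1); congr (cocenter_eq _ (T _));
  congr mk; ring.
Qed.

(* In O_i the elements mk (2 m - i) (2 i - m - 1) Ws1 have minimal length when
   0 <= 2 m - i <= 2; here 2 m - i is 1 for odd i and 2 for even i. *)
Definition refl_min (i : int) : ext_aff :=
  let m := ((i + 2) %/ 2)%Z in mk (2 * m - i) (2 * i - m - 1) Ws1.

Lemma refl_min_len a b g (i : int) : is_reflection g ->
  reflection_inv a b g = 3 * i - 2 -> (ell (refl_min i) <= mklen a b g)%N.
Proof. by rewrite /refl_min ellE; case: g => //= _; lia. Qed.

(** Once the linear part is [Ws1], minimality leaves a choice only for even [i]: first coordinate 0
    or 2. Conjugations by [s0] and [tau] identify the two. *)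
Lemma reduce_refl_min a b g (i : int) : is_reflection g ->
  reflection_inv a b g = 3 * i - 2 -> mklen a b g = ell (refl_min i) ->
  T (mk a b g) == T (refl_min i) %[cocenter].
Proof.
have Ws1_case c d : c + 2 * d = 3 * i - 2 -> mklen c d Ws1 = ell (refl_min i) ->
    T (mk c d Ws1) == T (refl_min i) %[cocenter].
  rewrite /refl_min ellE => inv len; set m := ((i + 2) %/ 2)%Z in len *.
  have [c0|c12] := eqVneq c 0.
    apply: cocenter_eq_sym.
    have mE : 2 * m - i = 2 by move: len; rewrite /= c0 /m; lia.
    have dE : d = 2 * i - m by lia.
    rewrite mE c0 dE.
    have e : T (mk 2 (2 * i - m - 1) Ws1) == T (mk (m - 2 * i) 0 Ws2) %[cocenter].
      apply: (reduce_same s0_simple); last by rewrite /=; lia.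
      by rewrite s0E !mkM /=; congr mk; ring.
    apply: cocenter_eq_trans e _.
    have := reduce_Ws2 (m - 2 * i) 0; congr (cocenter_eq _ (T _)).
    by congr mk; ring.
  have -> : c = 2 * m - i by move: len c12; rewrite /= /m; lia.
  have -> : d = 2 * i - m - 1 by move: len c12; rewrite /= /m; lia.
  exact: cocenter_eq_refl.
case: g => //= _ inv len; first exact: Ws1_case.
- apply: cocenter_eq_trans (reduce_Ws2 _ _) _; apply: Ws1_case; first by lia.
  by rewrite -len /=; lia.
- apply: cocenter_eq_trans (reduce_Ws121 _ _) _; apply: Ws1_case; first by lia.
  by rewrite -len /=; lia.
Qed.

(** Conjugation by [s0] keeps the length and prepares a drop by [s2]; powers of [tau] then restore
    the linear part [Ws1]. *)
Lemma reduce_refl_step (a b : int) : 3 <= a -> a + b <= 0 ->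
  T (mk a b Ws1) == T (mk (a - 2) (b + 1) Ws1) +
    ep *: T (mk (1 - a - b) (a - 2) W1) %[cocenter].
Proof.
move=> a3 ab.
have e1 : T (mk a b Ws1) == T (mk (- 1 - b) (2 - a) Ws2) %[cocenter].
  apply: (reduce_same s0_simple); last by rewrite /=; lia.
  by rewrite s0E !mkM /=; congr mk; ring.
have e2 : T (mk (- 1 - b) (2 - a) Ws2) == T (mk (1 - a - b) (a - 2) Ws2) +
    ep *: T (mk (1 - a - b) (a - 2) W1) %[cocenter].
  apply: (reduce_drop s2_simple); last by rewrite /=; lia.
    by rewrite s2E !mkM /=; congr mk; ring.
  by rewrite s2E !mkM /=; congr mk; ring.
apply: cocenter_eq_trans e1 (cocenter_eq_trans e2 _).
apply: cocenter_eqD; last exact: cocenter_eq_refl.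
have := reduce_Ws2 (1 - a - b) (a - 2); congr (cocenter_eq _ (T _)).
by congr mk; ring.
Qed.

Lemma reduce_refl_iter (n : nat) (a b : int) : 2 * n%:Z + 1 <= a -> a + b <= 0 ->
  T (mk a b Ws1) == T (mk (a - 2 * n%:Z) (b + n%:Z) Ws1) + ep *:
    (\sum_(i <- iota 0 n) T (mk (1 - a - b + i%:Z) (a - 2 * i%:Z - 2) W1))
  %[cocenter].
Proof.
elim: n => [|n IHn] an ab.
  rewrite big_nil scaler0 addr0 mulr0 subr0 addr0; exact: cocenter_eq_refl.
have iE : iota 0 n.+1 = iota 0 n ++ [:: n] by rewrite -addn1 iotaD add0n.
rewrite iE big_cat big_seq1 scalerDr addrA addrAC.
apply: cocenter_eq_trans (IHn _ ab) _; first by lia.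
apply: cocenter_eqD; last exact: cocenter_eq_refl.
have := @reduce_refl_step (a - 2 * n%:Z) (b + n%:Z).
have -> : a - 2 * n%:Z - 2 = a - 2 * n.+1%:Z by lia.
have -> : b + n%:Z + 1 = b + n.+1%:Z by lia.
have -> : 1 - (a - 2 * n%:Z) - (b + n%:Z) = 1 - a - b + n%:Z by ring.
by apply; lia.
Qed.

(* t^lam s2 s1 tau is the translation by lam minus the second fundamental
   coweight. *)
Definition dom_transl (lam : coweight) : ext_aff := mk lam.1 (lam.2 - 1) W1.

(* The number of elements of E'_{k alpha1 + (2k - 1) alpha2}. *)
Definition transl_count (k : nat) : nat := (3 * k - 2)./2.

Definition dom_weight (k i : nat) : coweight :=
  qvec k%:Z (2 * k%:Z - 1 - i%:Z).

(** [transl_count 1] is 0, so the blocks effectively start at index 2, as in the theorem. *)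
Fixpoint dom_weights (k : nat) : seq coweight :=
  if k is k'.+1 then
    [seq dom_weight k i | i <- iota 0 (transl_count k)] ++ dom_weights k'
  else [::].

Fixpoint refl_indices (k : nat) : seq int :=
  if k is k'.+1 then [:: - k'%:Z, 2 * k'%:Z + 1, 2 * k'%:Z + 2 & refl_indices k']
  else [::].

Definition expansion (k : nat) : H :=
  ep ^+ 2 *: (\sum_(lam <- dom_weights k) T (dom_transl lam)) +
  ep *: (\sum_(i <- refl_indices k) T (refl_min i)) + T tau.

Lemma reduce_expansion k : T (mk 1 (3 * k%:Z) Ws12) == expansion k %[cocenter].
Proof.
elim: k => [|k IHk].
  rewrite /expansion /= !big_nil !scaler0 !add0r tauE mulr0.
  exact: cocenter_eq_refl.
pose K : int := k%:Z + 1.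
have -> : 3 * k.+1%:Z = 3 * K by rewrite /K; lia.
(* The reflections left by [e2], [e3] and [e4] have invariants [6 * K - 2], [1 - 3 * K] and
   [6 * K - 5], that is [3 * i - 2] for [i] equal to [2 * K], [1 - K] and [2 * K - 1]. *)
have e1 : T (mk 1 (3 * K) Ws12) == T (mk (- 3 * K) 2 Ws21) %[cocenter].
  apply: (reduce_same s0_simple); last by rewrite /= /K; lia.
  by rewrite s0E !mkM /=; congr mk; ring.
have e2 : T (mk (- 3 * K) 2 Ws21) == T (mk (3 * K) (2 - 3 * K) Ws12) +
    ep *: T (mk (3 * K) (2 - 3 * K) Ws121) %[cocenter].
  apply: (reduce_drop s1_simple); last by rewrite /= /K; lia.
    by rewrite s1E !mkM /=; congr mk; ring.
  by rewrite s1E !mkM /=; congr mk; ring.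
have e3 : T (mk (3 * K) (2 - 3 * K) Ws12) == T (mk (3 * K - 2) (3 - 3 * K) Ws21) +
    ep *: T (mk (3 * K - 1) (1 - 3 * K) Ws1) %[cocenter].
  apply: (reduce_drop s0_simple); last by rewrite /= /K; lia.
    by rewrite s0E !mkM /=; congr mk; ring.
  by rewrite s0E !mkM /=; congr mk; ring.
have e4 : T (mk (3 * K - 2) (3 - 3 * K) Ws21) == T (mk 1 (3 * k%:Z) Ws12) +
    ep *: T (mk 1 (3 * k%:Z) Ws1) %[cocenter].
  apply: (reduce_drop s2_simple); last by rewrite /= /K; lia.
    by rewrite s2E !mkM /K /=; congr mk; ring.
  by rewrite s2E !mkM /K /=; congr mk; ring.
have r1 : T (mk (3 * K) (2 - 3 * K) Ws121) ==
    T (refl_min (2 * k%:Z + 2)) %[cocenter].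
  by apply: reduce_refl_min => //; rewrite /refl_min ?ellE /= /K; lia.
have r3 : T (mk 1 (3 * k%:Z) Ws1) == T (refl_min (2 * k%:Z + 1)) %[cocenter].
  by apply: reduce_refl_min => //; rewrite /refl_min ?ellE /=; lia.
have r2 : T (mk (3 * K - 1) (1 - 3 * K) Ws1) == T (refl_min (- k%:Z)) +
    ep *: (\sum_(i <- iota 0 (transl_count k.+1))
             T (dom_transl (dom_weight k.+1 i)))
    %[cocenter].
  set n := transl_count _.
  (* After [n] steps of 2 the first coordinate is 1 or 2, according to the parity of [K], as in
     [refl_min]. *)
  have nE : 2 * n%:Z + 1 = 3 * K - 1 \/ 2 * n%:Z + 2 = 3 * K - 1.
    by rewrite /n /transl_count /K; lia.
  apply: cocenter_eq_trans (reduce_refl_iter (n := n) _ _) _; try lia.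
  apply: cocenter_eqD.
    by apply: reduce_refl_min => //; rewrite /refl_min ?ellE /=; lia.
  apply: cocenter_eqZ; apply: cocenter_eq_sum => i _.
  have -> : mk (1 - (3 * K - 1) - (1 - 3 * K) + i%:Z)
      (3 * K - 1 - 2 * i%:Z - 2) W1 =
      dom_transl (dom_weight k.+1 i).
    by rewrite /dom_transl /dom_weight qvecE /=; congr mk; rewrite /K; lia.
  exact: cocenter_eq_refl.
apply: cocenter_eq_trans e1 (cocenter_eq_trans e2 _).
apply: cocenter_eq_trans (cocenter_eqD e3 (cocenter_eq_refl _)) _.
apply: cocenter_eq_trans (cocenter_eqD (cocenter_eqD e4 (cocenter_eqZ _ r2))
  (cocenter_eqZ _ r1)) _.
have IHr3 := cocenter_eqD IHk (cocenter_eqZ ep r3).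
apply: cocenter_eq_trans (cocenter_eqD (cocenter_eqD IHr3 (cocenter_eq_refl _))
  (cocenter_eq_refl _)) _.
rewrite /expansion [dom_weights k.+1]/= [refl_indices k.+1]/= !big_cons.
rewrite big_cat big_map.
set A := \sum_(_ <- dom_weights k) _; set B := \sum_(_ <- iota _ _) _.
set C := \sum_(_ <- refl_indices k) _.
rewrite !scalerDr [ep *: (ep *: _)]scalerA -expr2.
rewrite [X in cocenter_eq X _](AC (4*2*1) ((6*1)*(5*(4*(7*2)))*3)) /=.
exact: cocenter_eq_refl.
Qed.

End Reduction.

(** * The class polynomials *)

Lemma conj_classP x y : conj_class_of x y <-> conj_to x y.
Proof.
split; first by case=> g _ <-; exists g.
by case=> g ->; exists g.
Qed.

Lemma conj_class_eq x y : conj_to x y -> conj_class_of x = conj_class_of y.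
Proof.
move=> xy; apply/seteqP; split=> z /conj_classP h; apply/conj_classP.
- by apply: conj_to_trans h; apply: conj_to_sym.
- exact: conj_to_trans h.
Qed.

Lemma conj_classes_mem C x y : conj_classes C -> C x -> (C y <-> conj_to x y).
Proof.
case=> z _ <- /conj_classP zx; rewrite (conj_class_eq zx).
exact: conj_classP.
Qed.

Lemma conj_transl a b x : conj_to (mk a b W1) x ->
  exists h, x = mk (weyl_act h (a, b)).1 (weyl_act h (a, b)).2 W1.
Proof.
case=> g ->; have [c [d [h ->]]] := mkP g.
exists (weyl_inv h); rewrite conjgE mkV !mkM.
by case: h => /=; congr mk; ring.
Qed.

Lemma conj_reflection a b g x : is_reflection g -> conj_to (mk a b g) x ->
  exists c d h, [/\ x = mk c d h, is_reflection h
    & reflection_inv c d h = reflection_inv a b g].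
Proof.
move=> rg [k ->]; have [c [d [h ->]]] := mkP k.
rewrite conjgE mkV !mkM; do 3 eexists; split; first reflexivity.
  by case: g rg => // _; case: h.
by case: g rg => // _; case: h => /=; ring.
Qed.

Lemma conj_rotation a b g x : is_rotation g -> conj_to (mk a b g) x ->
  exists c d h, [/\ x = mk c d h, is_rotation h
    & component x = component (mk a b g)].
Proof.
move=> rg [k ->]; have [c [d [h ->]]] := mkP k.
rewrite conjgE mkV !mkM; do 3 eexists; split; first reflexivity.
  by case: g rg => // _; case: h.
by rewrite !component_mk; case: g rg => // _; case: h => /=; lia.
Qed.

Lemma qvec_tE m n : t (qvec m n) = mk (2 * m - n) (2 * n - m) W1.
Proof. by rewrite qvecE. Qed.

Lemma O_domE lam : O_dom lam = conj_class_of (dom_transl lam).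
Proof.
case: lam => a b; rewrite /O_dom /dom_transl tE !genE !mkM /=.
by congr conj_class_of; congr mk; ring.
Qed.

(** The three families are the reflections with [reflection_inv] equal to [3 * i - 2], a complete
    invariant for reflections. *)
Lemma O_reflE i : O_refl i = conj_class_of (refl_min i).
Proof.
have minE : reflection_inv (2 * ((i + 2) %/ 2)%Z - i)
    (2 * i - ((i + 2) %/ 2)%Z - 1) Ws1 = 3 * i - 2 by rewrite /=; lia.
apply/seteqP; split=> x.
  case=> k xE; apply/conj_classP.
  have [c [d [h [-> rh invh]]]] : exists c d h, [/\ x = mk c d h, is_reflection h
      & reflection_inv c d h = 3 * i - 2].
    by case: xE => ->; rewrite qvec_tE !genE !mkM; do 3 eexists;
      (split; first reflexivity) => //=; ring.
  by apply: conj_to_reflection; rewrite // minE invh.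
case/conj_classP/(conj_reflection (isT : is_reflection Ws1)) => c [d [h [-> rh]]].
rewrite minE; case: h rh => //= _ inv.
- exists (2 * i - 1 - d); apply: Or31; rewrite qvec_tE !genE !mkM /=.
  by congr mk; lia.
- exists (1 - 2 * i - c); apply: Or33; rewrite qvec_tE !genE !mkM /=.
  by congr mk; lia.
- exists (c - 2 * i + 1); apply: Or32; rewrite qvec_tE !genE !mkM /=.
  by congr mk; lia.
Qed.

(** The two families are the rotations of component 1. *)
Lemma O_idE : O_id = conj_class_of tau.
Proof.
apply/seteqP; split=> x.
  case=> m [n xE]; apply/conj_classP; rewrite tauE.
  by case: xE => ->; rewrite qvec_tE !genE !mkM /=; apply: conj_to_rotation => //;
    rewrite !component_mk; lia.
rewrite tauE; case/conj_classP/(conj_rotation (isT : is_rotation Ws12)).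
move=> c [d [h [-> rh]]].
rewrite !component_mk; case: h rh => //= _ comp.
- exists ((2 * (c - 1) + d) %/ 3)%Z, ((c - 1 + 2 * d) %/ 3)%Z; left.
  by rewrite qvec_tE tauE !mkM /=; congr mk; lia.
- exists ((2 * (c + 1) + (d - 1)) %/ 3)%Z, ((c + 1 + 2 * (d - 1)) %/ 3)%Z; right.
  by rewrite qvec_tE !genE !mkM /=; congr mk; lia.
Qed.

Lemma conj_class_of_classes x : conj_classes (conj_class_of x).
Proof. by exists x. Qed.

Lemma conj_class_of_refl x : conj_class_of x x.
Proof. by apply/conj_classP; apply: conj_to_refl. Qed.

(** An expansion quantifies over all choices of representatives; two expansions can be compared only
    if some choice exists. *)
Lemma min_length_reps : exists rep : set ext_aff -> ext_aff,
  forall C, conj_classes C -> min_length_in C (rep C).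
Proof.
suff /choice[rep repE] C : exists x, conj_classes C -> min_length_in C x.
  by exists rep.
have [[x _ <-]|nC] := pselect (conj_classes C); last by exists 1%g => /nC.
pose P n := `[< exists2 y, conj_class_of x y & ell y = n >].
have exP : exists n, P n.
  by exists (ell x); apply/asboolP; exists x => //; apply: conj_class_of_refl.
case: (ex_minnP exP) => n /asboolP[y xy yn] n_min; exists y => _; split=> // z xz.
by rewrite yn; apply: n_min; apply/asboolP; exists z.
Qed.

Lemma dom_weightsP k lam : reflect
  ((\bigcup_(j in [set j : nat | (2 <= j <= k)%N])
      Eprime j%:Z (2 * j%:Z - 1)) lam)
  (lam \in dom_weights k).
Proof.
elim: k => [|k IHk]; first by apply: ReflectF => -[j /= j0]; lia.
rewrite mem_cat; apply: (iffP orP) => [[/mapP[i]|/IHk[j jk lamj]]|[j jk lamj]].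
- rewrite mem_iota => /andP[_ ltn] ->; rewrite /transl_count in ltn.
  exists k.+1; first by rewrite /=; lia.
  exists (2 * k.+1%:Z - 1 - i%:Z) => //=; lia.
- by exists j => //; move: jk => /=; lia.
have [ltjk|] := leqP j k.
  by right; apply/IHk; exists j => //; move: jk => /=; lia.
move=> ltkj; have jE : j = k.+1 by move: jk => /=; lia.
left; apply/mapP; case: lamj => n /= n_bounds <-; rewrite jE in n_bounds *.
exists (absz (2 * k.+1%:Z - 1 - n)%R).
  by rewrite mem_iota /transl_count; lia.
by rewrite /dom_weight; congr qvec; lia.
Qed.

Lemma refl_indicesP k i : (i \in refl_indices k) = (- k%:Z + 1 <= i <= 2 * k%:Z).
Proof. by elim: k => [|k IHk]; rewrite /= ?inE ?IHk; lia. Qed.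

Lemma qvec_inj m n m' n' : qvec m n = qvec m' n' -> m = m' /\ n = n'.
Proof. by rewrite !qvecE => -[]; lia. Qed.

Lemma dom_weights_uniq k : uniq (dom_weights k).
Proof.
elim: k => [//|k IHk]; rewrite cat_uniq IHk andbT map_inj_uniq ?iota_uniq /=.
  apply/hasPn => lam /dom_weightsP[j jk [n _ <-]]; apply/mapP => -[i _].
  by move/qvec_inj => -[]; move: jk => /=; lia.
by move=> i j /qvec_inj[]; lia.
Qed.

Lemma refl_indices_uniq k : uniq (refl_indices k).
Proof. by elim: k => [//|k IHk]; rewrite /= !inE !refl_indicesP IHk; lia. Qed.

(** These bounds make [dom_transl lam] strictly dominant, so distinct weights give distinct Weyl
    orbits. *)
Lemma dom_weights_regular k lam :
  lam \in dom_weights k -> 1 <= lam.1 /\ 2 <= lam.2.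
Proof.
move/dom_weightsP=> [j jk [n /= n_bounds <-]]; rewrite qvecE /=.
by move: jk => /=; lia.
Qed.

Lemma O_dom_inj k : {in dom_weights k &, injective O_dom}.
Proof.
move=> [a b] [c d] /dom_weights_regular /= ab /dom_weights_regular /= cd.
rewrite !O_domE => e; have := conj_class_of_refl (dom_transl (c, d)).
rewrite -e => /conj_classP/conj_transl[h /mk_inj[/= e1 e2 _]].
by case: h e1 e2 => /= e1 e2; congr pair; lia.
Qed.

Lemma O_refl_inj : injective O_refl.
Proof.
move=> i j; rewrite !O_reflE => e; have := conj_class_of_refl (refl_min j).
rewrite -e => /conj_classP/(conj_reflection (isT : is_reflection Ws1)).
by case=> c [d [h [/mk_inj[<- <- <-] _ /=]]]; lia.
Qed.

Lemma O_dom_neq_refl lam i : O_dom lam <> O_refl i.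
Proof.
rewrite O_domE O_reflE => e; have := conj_class_of_refl (refl_min i).
by rewrite -e => /conj_classP/conj_transl[h /mk_inj[]].
Qed.

Lemma O_dom_neq_id lam : O_dom lam <> O_id.
Proof.
rewrite O_domE O_idE => e; have := conj_class_of_refl tau.
by rewrite -e tauE => /conj_classP/conj_transl[h /mk_inj[]].
Qed.

Lemma O_refl_neq_id i : O_refl i <> O_id.
Proof.
rewrite O_reflE O_idE => e; have := conj_class_of_refl tau.
rewrite -e tauE => /conj_classP/(conj_reflection (isT : is_reflection Ws1)).
by case=> c [d [h [/mk_inj[_ _ <-]]]].
Qed.

Lemma fsbig_conj_classes (V : nmodType) (F : set ext_aff -> V)
    (S : seq (set ext_aff)) : uniq S -> (forall C, C \in S -> conj_classes C) ->
  (forall C, conj_classes C -> C \notin S -> F C = 0) ->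
  \sum_(C \in conj_classes) F C = \sum_(C <- S) F C.
Proof.
move=> uS Scl F0; rewrite (fsbigE S) //.
rewrite big_seq_cond [RHS]big_seq; apply: eq_bigl => C.
by case: (boolP (C \in S)) => // /Scl Ccl; rewrite mem_set.
Qed.

Definition expansion_classes (k : nat) : seq (set ext_aff) :=
  [seq O_dom lam | lam <- dom_weights k] ++
  [seq O_refl i | i <- refl_indices k] ++ [:: O_id].

Lemma expansion_classes_uniq k : uniq (expansion_classes k).
Proof.
rewrite !cat_uniq (map_inj_in_uniq (@O_dom_inj k)) dom_weights_uniq.
rewrite (map_inj_uniq O_refl_inj) refl_indices_uniq /= orbF !andbT.
apply/andP; split.
  apply/hasPn => C; rewrite mem_cat inE => /orP[/mapP[i _ ->]|/eqP->];
    apply/mapP => -[lam _]; first by move/esym; apply: O_dom_neq_refl.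
  by move/esym; apply: O_dom_neq_id.
by apply/mapP => -[i _ /esym]; apply: O_refl_neq_id.
Qed.

Lemma expansion_classes_conj k C : C \in expansion_classes k -> conj_classes C.
Proof.
rewrite !mem_cat inE => /or3P[/mapP[lam _ ->]|/mapP[i _ ->]|/eqP->];
  rewrite ?O_domE ?O_reflE ?O_idE; exact: conj_class_of_classes.
Qed.

Definition expansion_coef (k : nat) (C : set ext_aff) : laurent :=
  if C \in [seq O_dom lam | lam <- dom_weights k] then (v - vinv) ^+ 2
  else if C \in [seq O_refl i | i <- refl_indices k] then v - vinv
  else if C == O_id then 1 else 0.

Section ClassPolynomials.

Variables (H : algType laurent) (T : ext_aff -> H).
Hypothesis hH : is_hecke_algebra T.

Lemma min_length_dom lam x : min_length_in (O_dom lam) x ->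
  cocenter_eq (T x) (T (dom_transl lam)).
Proof.
rewrite O_domE => -[/conj_classP/conj_transl[h ->] _].
by apply: cocenter_eq_sym; apply: (reduce_transl hH).
Qed.

(** By [refl_min_len] the element [refl_min i] is itself minimal, so [x] has its length. *)
Lemma min_length_refl i x : min_length_in (O_refl i) x ->
  cocenter_eq (T x) (T (refl_min i)).
Proof.
rewrite O_reflE => -[/conj_classP xC x_min].
have le_x := x_min _ (conj_class_of_refl _).
case/(conj_reflection (isT : is_reflection Ws1)): xC => c [d [h [xE rh inv]]].
have invE : reflection_inv c d h = 3 * i - 2 by rewrite inv /=; lia.
rewrite xE; apply: (reduce_refl_min hH) => //.
apply/eqP; rewrite eqn_leq refl_min_len // andbT.
by move: le_x; rewrite xE ellE.
Qed.

Lemma min_length_id x : min_length_in O_id x -> x = tau.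
Proof.
rewrite O_idE => -[/conj_classP xC x_min].
have := x_min _ (conj_class_of_refl _); rewrite (ell_tauX 1) leqn0 => /eqP x0.
have [j lt3 xE] := ell_eq0 x0.
move: xC; rewrite tauE => /(conj_rotation (isT : is_rotation Ws12)).
have [t0 t1 t2 _] := tauXE; move: xE.
case: j lt3 => [|[|[|//]]] _; rewrite ?t0 ?t1 ?t2 => -> //.
- by case=> c [d [h [/mk_inj[_ _ <-]]]].
- by case=> c [d [h [_ _]]]; rewrite !component_mk.
Qed.

Lemma expansion_rep k (rep : set ext_aff -> ext_aff) :
  (forall C, conj_classes C -> min_length_in C (rep C)) ->
  cocenter_eq (expansion T k)
    (\sum_(C <- expansion_classes k) expansion_coef k C *: T (rep C)).
Proof.
move=> rep_min; rewrite !big_cat big_seq1 !big_map /= addrA.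
have rep_in C : C \in expansion_classes k -> min_length_in C (rep C).
  by move/expansion_classes_conj/rep_min.
have coef_id : expansion_coef k O_id = 1.
  rewrite /expansion_coef eqxx ifF; last first.
    by apply/mapP => -[lam _ /esym]; apply: O_dom_neq_id.
  by rewrite ifF //; apply/mapP => -[i _ /esym]; apply: O_refl_neq_id.
apply: cocenter_eqD; last first.
  rewrite coef_id scale1r (min_length_id (rep_in O_id _)).
    exact: cocenter_eq_refl.
  by rewrite !mem_cat mem_head !orbT.
apply: cocenter_eqD; rewrite scaler_sumr; apply: cocenter_eq_sum => y yk.
- rewrite /expansion_coef (map_f O_dom yk); apply: cocenter_eqZ.
  apply: cocenter_eq_sym; apply: min_length_dom; apply: rep_in.
  by rewrite !mem_cat map_f.
- rewrite /expansion_coef (map_f O_refl yk) ifF; last first.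
    by apply/mapP => -[lam _ /esym]; apply: O_dom_neq_refl.
  apply: cocenter_eqZ; apply: cocenter_eq_sym; apply: min_length_refl.
  by apply: rep_in; rewrite !mem_cat map_f ?orbT.
Qed.

Lemma expansion_coef_supp k C :
  expansion_coef k C != 0 -> C \in expansion_classes k.
Proof.
rewrite /expansion_coef !mem_cat inE.
by case: ifP => // _; case: ifP => // _; case: (C =P O_id); rewrite ?eqxx.
Qed.

Lemma class_expansion_coef k :
  class_expansion T (mk 1 (3 * k%:Z) Ws12) (expansion_coef k).
Proof.
split=> [|rep rep_min].
  apply: (sub_finite_set _ (finite_seq (expansion_classes k))) => C [_] /=.
  exact: expansion_coef_supp.
rewrite (fsbig_conj_classes (expansion_classes_uniq k)).
- exact: cocenter_eq_trans (reduce_expansion hH k) (expansion_rep _ _).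
- exact: expansion_classes_conj.
- move=> C _ CS; rewrite (_ : expansion_coef k C = 0) ?scale0r //.
  by apply: contraNeq CS; apply: expansion_coef_supp.
Qed.

(** The difference is summed over one finite list containing both supports and [C]; representatives
    of distinct classes are not conjugate, so independence applies. *)
Lemma class_expansion_unique w (c c' : set ext_aff -> laurent) C :
  class_expansion T w c -> class_expansion T w c' -> conj_classes C -> c C = c' C.
Proof.
move=> [/finite_seqP[s sE] c_exp] [/finite_seqP[s' s'E] c'_exp] Ccl.
have [rep rep_min] := min_length_reps.
pose S := undup (C :: s ++ s').
have S_s D : conj_classes D -> c D != 0 -> D \in S.
  move=> Dcl cD; rewrite mem_undup inE mem_cat.
  by rewrite (_ : D \in s) ?orbT //; have : [set` s] D by rewrite -sE.
have S_s' D : conj_classes D -> c' D != 0 -> D \in S.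
  move=> Dcl cD; rewrite mem_undup inE mem_cat.
  by rewrite (_ : D \in s') ?orbT //; have : [set` s'] D by rewrite -s'E.
have Scl D : D \in S -> conj_classes D.
  rewrite mem_undup inE mem_cat => /or3P[/eqP->//|Ds|Ds'].
  - by have : [set` s] D by []; rewrite -sE => -[].
  - by have : [set` s'] D by []; rewrite -s'E => -[].
have sumE a : (forall D, conj_classes D -> a D != 0 -> D \in S) ->
    \sum_(D \in conj_classes) a D *: T (rep D) = \sum_(D <- S) a D *: T (rep D).
  move=> aS; apply: fsbig_conj_classes => //; first exact: undup_uniq.
  move=> D Dcl; apply: contraNeq => aD; apply: aS => //.
  by apply: contraNneq aD => ->; rewrite scale0r.
have := cocenter_eq_trans (cocenter_eq_sym (c_exp _ rep_min)) (c'_exp _ rep_min).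
rewrite (sumE c S_s) (sumE c' S_s') /cocenter_eq -sumrB.
rewrite (eq_bigr (fun D => (c D - c' D) *: T (rep D))); last first.
  by move=> D _; rewrite scalerBl.
move/(hecke_cocenter_independence hH (undup_uniq _)) => ind.
apply: subr0_eq; apply: (ind _ C); last by rewrite mem_undup mem_head.
move=> D D' /Scl Dcl /Scl D'cl DD'.
have [DD _] := rep_min _ Dcl; have [DD'' _] := rep_min _ D'cl.
apply/seteqP; split=> z.
- by move/(conj_classes_mem z Dcl DD) => h; apply/(conj_classes_mem z D'cl DD'');
    apply: conj_to_trans h; apply: conj_to_sym.
- by move/(conj_classes_mem z D'cl DD'') => h; apply/(conj_classes_mem z Dcl DD);
    apply: conj_to_trans h.
Qed.

Lemma class_polyE w c C : class_expansion T w c -> conj_classes C ->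
  class_poly T w C = c C.
Proof.
move=> c_exp Ccl; rewrite /class_poly; case: xgetP => [c' _ c'_exp|/(_ c)//].
exact: class_expansion_unique c'_exp c_exp Ccl.
Qed.

End ClassPolynomials.

Theorem proposition2p24 (H : algType laurent) (T : ext_aff -> H)
    (hH : is_hecke_algebra T) (k : nat)
    (O : set ext_aff) (hO : conj_classes O) :
  class_poly T (t (qvec k%:Z (2 * k%:Z)) * tau)%g O =
    if O \in [set O_dom lam | lam in
              \bigcup_(j in [set j : nat | (2 <= j <= k)%N])
                Eprime j%:Z (2 * j%:Z - 1)]
    then (v - vinv) ^+ 2
    else if O \in [set O_refl i | i in
                   [set i : int | - k%:Z + 1 <= i <= 2 * k%:Z]]
    then v - vinv
    else if O == O_id then 1
    else 0.
Proof.
have -> : (t (qvec k%:Z (2 * k%:Z)) * tau)%g = mk 1 (3 * k%:Z) Ws12.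
  by rewrite qvec_tE tauE mkM /=; congr mk; ring.
rewrite (class_polyE hH (class_expansion_coef hH k) hO) /expansion_coef.
have -> : (O \in [set O_dom lam | lam in
    \bigcup_(j in [set j : nat | (2 <= j <= k)%N]) Eprime j%:Z (2 * j%:Z - 1)]) =
    (O \in [seq O_dom lam | lam <- dom_weights k]).
  apply/idP/mapP => [/set_mem[lam /dom_weightsP lamk <-]|
    [lam /dom_weightsP lamk ->]].
    by exists lam.
  by apply/mem_set; exists lam.
have -> // : (O \in [set O_refl i | i in
    [set i : int | - k%:Z + 1 <= i <= 2 * k%:Z]]) =
    (O \in [seq O_refl i | i <- refl_indices k]).
apply/idP/mapP => [/set_mem[i /= ik <-]|[i ik ->]].
  by exists i; rewrite // refl_indicesP.
by apply/mem_set; exists i; rewrite //= -refl_indicesP.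
Qed.
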